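(* Fix $\alpha\in(0,1)$. There exist constants $C_1^*(\alpha),C_2^*(\alpha)$ depending only on $\alpha$ such that the following holds. Let $\beta_{(1)}^2\ge\dots\ge\beta_{(d)}^2$ be the order statistics of $\beta_1^2,\dots,\beta_d^2$, and suppose $k$ is the smallest integer in $\{1,\dots,d\}$ such that $$\frac{2\beta_{(k)}^2}{\sigma^2 b_k(\Sigma)}<-\tfrac12\log\alpha.$$ Then every knockoff procedure at FDR level $\alpha$ (with any diagonal $\Delta\succeq\Sigma$ and any ordering/sign rule, both possibly chosen with full knowledge of $\beta$ and $\sigma^2$) satisfies $\mathbb E R\le C_1^*(\alpha)k+C_2^*(\alpha)$.
   Context: Whitening setup: $\Sigma\in\mathbb R^{d\times d}$ symmetric positive definite, $\beta\in\mathbb R^d$, $\sigma^2>0$, $\widehat\beta\sim\mathcal N_d(\beta,\sigma^2\Sigma)$. A knockoff procedure at level $\alpha$ consists of a diagonal $\Delta\succeq\Sigma$ ($\succeq$ the positive semidefinite order), noise $\omega\sim\mathcal N_d(0,\sigma^2(\Delta-\Sigma))$ independent of $\widehat\beta$, $\widetilde\beta=\widehat\beta+\omega$, $\xi=\Sigma^{-1}\widehat\beta-\Delta^{-1}\widetilde\beta$, and a rule that, as a function of $(\xi,|\widetilde\beta|)$ (and possibly of $\beta,\sigma^2$ and independent auxiliary randomness), outputs an ordering $[1],\dots,[d]$ and signs $\psi_j\in\{\pm1\}$; $\widetilde p_j=1/2$ if $\operatorname{sgn}(\widetilde\beta_j)=\psi_j$, else $1$; $\widehat{\mathrm{FDP}}_k=\frac{1+\#\{j\le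 k:\widetilde p_{[j]}=1\}}{\#\{j\le k:\widetilde p_{[j]}=1/2\}}$; $\hat k=\max\{k:\widehat{\mathrm{FDP}}_k\le\alpha\}$ ($0$ if none); rejections are the $H_{[j]}:\beta_{[j]}=0$, $j\le\hat k$, with $\widetilde p_{[j]}=1/2$; $R$ is their number. For $\Sigma$ with eigenvalues $\lambda_1\ge\dots\ge\lambda_d$ and orthonormal eigenvectors $u_1,\dots,u_d$, and $u_{\ell,(1)}^2\le\dots\le u_{\ell,(d)}^2$ the order statistics of the squared entries of $u_\ell$, define $b_k(\Sigma)=\max_{\ell\le d}\lambda_\ell\sum_{j=1}^k u_{\ell,(j)}^2$. *)

(* Defs.v *)
From HB Require Import structures.
From mathcomp Require Import all_boot all_order all_algebra.
From mathcomp Require Import fingroup perm.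
From mathcomp Require Import all_classical all_reals all_analysis.
Set Implicit Arguments. Unset Strict Implicit. Unset Printing Implicit Defensive.
Import Order.TTheory GRing.Theory Num.Theory.
Local Open Scope classical_set_scope.
Local Open Scope ring_scope.

Definition sym_mx {R : realType} {n : nat} (M : 'M[R]_n) : Prop := M^T = M.

Definition psd_mx {R : realType} {n : nat} (M : 'M[R]_n) : Prop :=
  sym_mx M /\ forall v : 'rV[R]_n, 0 <= (v *m M *m v^T) 0 0.

Definition pd_mx {R : realType} {n : nat} (M : 'M[R]_n) : Prop :=
  sym_mx M /\ forall v : 'rV[R]_n, v != 0 -> 0 < (v *m M *m v^T) 0 0.

(** beta_{(k)}^2 : the k-th largest of beta_1^2,...,beta_d^2 (k is 1-indexed) *)
Definition beta_ord2 {R : realType} {d : nat} (beta : 'rV[R]_d) (k : nat) : R :=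
  nth 0 (sort (fun x y : R => y <= x) [seq beta 0 i ^+ 2 | i <- enum 'I_d]) k.-1.

(** b_k(Sigma) = max_l lam_l * (sum of the k smallest squared entries of u_l),
    where u_l = col l Q is the l-th orthonormal eigenvector with eigenvalue lam l *)
Definition b_k {R : realType} {d : nat} (Q : 'M[R]_d) (lam : 'I_d -> R) (k : nat) : R :=
  \big[Num.max/0]_(l < d)
     (lam l * \sum_(x <- take k (sort (fun x y : R => x <= y)
                                   [seq Q i l ^+ 2 | i <- enum 'I_d])) x).

(** the defining inequality  2 beta_{(k)}^2 / (sigma^2 b_k) < -(1/2) log alpha,
    written multiplicatively (division by b_k = 0 read as +infinity) *)
Definition k_cond {R : realType} {d : nat} (alpha sigma2 : R) (beta : 'rV[R]_d)
  (Q : 'M[R]_d) (lam : 'I_d -> R) (k : nat) : Prop :=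
  2 * beta_ord2 beta k < (- (1/2) * ln alpha) * (sigma2 * b_k Q lam k).

(** p~_j = 1/2  iff  sgn(beta~_j) = psi_j  (psi j = true encodes +1) *)
Definition phalf {R : realType} {d : nat} (bt : 'rV[R]_d)
  (psi : {ffun 'I_d -> bool}) (j : 'I_d) : bool :=
  Num.sg (bt 0 j) == (if psi j then 1 else -1).

(** #{ j <= k : p~_[j] = 1/2 }  ([j] = s (j-1), 0-indexed positions j < k) *)
Definition n_half {R : realType} {d : nat} (bt : 'rV[R]_d) (s : {perm 'I_d})
  (psi : {ffun 'I_d -> bool}) (k : nat) : nat :=
  #|[set j : 'I_d | (j < k)%N && phalf bt psi (s j)]|.

Definition n_one {R : realType} {d : nat} (bt : 'rV[R]_d) (s : {perm 'I_d})
  (psi : {ffun 'I_d -> bool}) (k : nat) : nat :=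
  #|[set j : 'I_d | (j < k)%N && ~~ phalf bt psi (s j)]|.

(** FDP^_k <= alpha, i.e. (1 + n_one k) / n_half k <= alpha
    (with the convention that a zero denominator gives +infinity) *)
Definition fdp_le {R : realType} {d : nat} (alpha : R) (bt : 'rV[R]_d)
  (s : {perm 'I_d}) (psi : {ffun 'I_d -> bool}) (k : nat) : bool :=
  (0 < n_half bt s psi k)%N &&
  ((1 + n_one bt s psi k)%:R / (n_half bt s psi k)%:R <= alpha).

Definition khat {R : realType} {d : nat} (alpha : R) (bt : 'rV[R]_d)
  (s : {perm 'I_d}) (psi : {ffun 'I_d -> bool}) : nat :=
  \max_(k < d.+1 | (1 <= k)%N && fdp_le alpha bt s psi k) (k : nat).

Definition n_rej {R : realType} {d : nat} (alpha : R) (bt : 'rV[R]_d)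
  (s : {perm 'I_d}) (psi : {ffun 'I_d -> bool}) : nat :=
  n_half bt s psi (khat alpha bt s psi).

(** Whole procedure, as a function of a standard Gaussian vector z in R^(d+d)
    and of the auxiliary randomness a:
      beta^  = beta + sigma * (z_1 A^T)   ~ N(beta, sigma^2 Sigma)  when A A^T = Sigma
      omega  = sigma * (z_2 B^T)          ~ N(0, sigma^2 (Delta - Sigma)) when B B^T = Delta - Sigma
      beta~  = beta^ + omega
      xi     = Sigma^-1 beta^ - Delta^-1 beta~
      (ordering, signs) = rule xi |beta~| a. *)
Definition knockoff_R {R : realType} {d : nat} {Aux : Type} (alpha sigma2 : R)
  (beta : 'rV[R]_d) (Sigma Delta A B : 'M[R]_d)
  (rule : 'rV[R]_d -> 'rV[R]_d -> Aux -> {perm 'I_d} * {ffun 'I_d -> bool})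
  (z : 'rV[R]_(d + d)) (a : Aux) : nat :=
  let bhat := beta + Num.sqrt sigma2 *: (lsubmx z *m A^T) in
  let omega := Num.sqrt sigma2 *: (rsubmx z *m B^T) in
  let btil := bhat + omega in
  let xi := bhat *m invmx Sigma - btil *m invmx Delta in
  let out := rule xi (map_mx Num.norm btil) a in
  n_rej alpha btil out.1 out.2.

Definition std_gauss_indep {R : realType} {dT : measure_display}
  {T : measurableType dT} (P : probability T R) {n : nat} (Z : T -> 'rV[R]_n)
  {dA : measure_display} {Aux : measurableType dA} (U : T -> Aux) : Prop :=
  (forall i : 'I_n, measurable_fun setT (fun t => Z t 0 i)) /\
  measurable_fun setT U /\
  forall (Bs : 'I_n -> set R) (C : set Aux),
    (forall i, measurable (Bs i)) -> measurable C ->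
    P (U @^-1` C `&` \bigcap_(i in [set: 'I_n]) ((fun t => Z t 0 i) @^-1` Bs i))
    = (P (U @^-1` C) * \prod_(i < n) normal_prob 0 1 (Bs i))%E.

(** measurability of the ordering/sign rule w.r.t. the product sigma-algebra
    on R^d x R^d x Aux (generated by coordinate cylinders) *)
Definition input_cylinders {R : realType} {d : nat} {dA : measure_display}
  (Aux : measurableType dA) : set (set ('rV[R]_d * 'rV[R]_d * Aux)) :=
  [set S | (exists (i : 'I_d) (Bs : set R), measurable Bs /\ S = [set x : 'rV[R]_d * 'rV[R]_d * Aux | Bs (x.1.1 0 i)])
        \/ (exists (i : 'I_d) (Bs : set R), measurable Bs /\ S = [set x : 'rV[R]_d * 'rV[R]_d * Aux | Bs (x.1.2 0 i)])
        \/ (exists C : set Aux, measurable C /\ S = [set x : 'rV[R]_d * 'rV[R]_d * Aux | C x.2])].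

Definition rule_measurable {R : realType} {d : nat} {dA : measure_display}
  {Aux : measurableType dA}
  (rule : 'rV[R]_d -> 'rV[R]_d -> Aux -> {perm 'I_d} * {ffun 'I_d -> bool}) : Prop :=
  forall o, <<s @input_cylinders R d dA Aux >> [set x | rule x.1.1 x.1.2 x.2 = o].

(* Main.v *)
Require Import Defs.
From HB Require Import structures.
From mathcomp Require Import all_boot all_order all_algebra.
From mathcomp Require Import fingroup perm.
From mathcomp Require Import all_classical all_reals all_analysis.
From mathcomp Require Import measurable_realfun.
From mathcomp Require Import ring lra.
Import Order.TTheory GRing.Theory Num.Theory.
Local Open Scope classical_set_scope.
Local Open Scope ring_scope.

(* The vector (beta^, omega) is an affine image of a standard Gaussian z, and for
   each j the affine reflection of z in the hyperplane {beta~_j = 0} flips the sign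
   of beta~_j while fixing xi and |beta~|. It changes the Gaussian density by the
   factor exp(-2 beta_j beta~_j / (sigma^2 Delta_jj)), so given (xi, |beta~|) the
   events {p~_j = 1/2} are independent with odds at most
   exp(2 |beta_j| |beta~_j| / (sigma^2 Delta_jj)).
   Call j strong if these odds exceed alpha^(-1/2). Off the strong indices the
   walk (number of p~ = 1/2) - alpha^(-3/4) (number of p~ = 1) has negative drift,
   so its exponential moments decay geometrically and a union bound over time
   gives E R <= D1 E #strong + D2. By Markov, P(j strong) <= K v_j with
   v_j = 2 beta_j^2 / (sigma^2 Delta_jj).
   Finally, Delta >= Sigma gives lambda_l sum_j u_lj^2 / Delta_jj <= 1; if tau is the
   k-th smallest u_lj^2 then b_k <= k lambda_l tau for the maximizing l, hence
   sum b_k / Delta_jj <= k over the j with u_lj^2 >= tau. So, up to at most 2k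
   indices, sum v_j <= (-log alpha / 2) k, and E #strong = O(k). *)

Set Implicit Arguments. Unset Strict Implicit. Unset Printing Implicit Defensive.

(** * One-dimensional Gaussian integrals *)

Section one_dim.
Context {R : realType}.
Notation leb := (@lebesgue_measure R).

Lemma lebesgue_measure_shift (h : R) (A : set R) : measurable A ->
  pushforward leb ((fun x => x + h) : _ -> measurableTypeR R) A = leb A.
Proof.
have mh : measurable_fun [set: measurableTypeR R]
    ((fun x => x + h) : _ -> measurableTypeR R) by exact: measurable_funD.
move=> mA; apply/esym.
apply: (@lebesgue_measure_unique R (pushforward leb _)) => //= _ [[a b]] _ <-.
rewrite /pushforward.
rewrite (_ : _ @^-1` _ = `](a - h), (b - h)]%classic); last first.
  by apply/seteqP; split => x /=; rewrite !in_itv /=; move=> /andP[? ?]; apply/andP; split; lra.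
rewrite !lebesgue_measure_itv /= !lte_fin ltrD2r.
case: ifP => // _; rewrite -!EFinB; congr EFin; ring.
Qed.

Lemma ge0_integral_shift (h : R) (f : R -> \bar R) :
  measurable_fun setT f -> (forall x, 0 <= f x)%E ->
  (\int[leb]_x f (x + h)%R = \int[leb]_x f x)%E.
Proof.
move=> mf f0.
have mh : measurable_fun [set: measurableTypeR R]
    ((fun x => x + h) : _ -> measurableTypeR R) by exact: measurable_funD.
rewrite -[LHS](@ge0_integral_pushforward _ _ _ _ R _ mh leb setT f)//.
by apply: eq_measure_integral => //= A mA _; exact: lebesgue_measure_shift.
Qed.

Lemma ge0_integral_opp (f : R -> \bar R) :
  measurable_fun setT f -> (forall x, 0 <= f x)%E ->
  (\int[leb]_x f (- x)%R = \int[leb]_x f x)%E.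
Proof.
move=> mf f0.
have mh : measurable_fun [set: measurableTypeR R]
    ((-%R) : _ -> measurableTypeR R) by exact: oppr_measurable.
rewrite -[LHS](@ge0_integral_pushforward _ _ _ _ R _ mh leb setT f)//.
by apply: eq_measure_integral => //= A mA _; exact: lebesgue_measureN.
Qed.

(** Change of variables introduces the Radon-Nikodym derivative of the normal law. It agrees almost
    everywhere with [normal_pdf], because both have the same integral over every measurable set. *)
Lemma ge0_integral_normal_prob (m s : R) (f : R -> \bar R) :
  measurable_fun setT f -> (forall x, 0 <= f x)%E ->
  (\int[normal_prob m s]_x f x = \int[leb]_x (f x * (normal_pdf m s x)%:E))%E.
Proof.
move=> mf f0.
pose nu : {finite_measure set _ -> \bar R} := normal_prob m s.
have dom : nu `<< leb := normal_prob_dominates m s.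
rewrite -(Radon_Nikodym_SigmaFinite.change_of_variables dom f0 measurableT mf).
apply: ae_eq_integral => //.
- apply: emeasurable_funM => //.
  exact: (measurable_int _ (Radon_Nikodym_SigmaFinite.f_integrable dom)).
- apply: emeasurable_funM => //; apply/measurable_EFinP; exact: measurable_normal_pdf.
- apply: ae_eqe_mul2l; apply: integral_ae_eq => //=.
  + exact: Radon_Nikodym_SigmaFinite.f_integrable.
  + by apply/measurable_EFinP; exact: measurable_normal_pdf.
  + move=> E _ mE; rewrite -(Radon_Nikodym_SigmaFinite.f_integral dom) //.
Qed.

Lemma normal_pdf01E (x y : R) :
  normal_pdf 0 1 y = normal_pdf 0 1 x * expR ((x ^+ 2 - y ^+ 2) / 2).
Proof.
rewrite /normal_pdf oner_eq0 /normal_fun -mulrA -expRD; congr (_ * expR _).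
rewrite !subr0 expr1n; lra.
Qed.

(** The substitution y = ±x + h preserves Lebesgue measure, and the exponential factor turns the
    Gaussian density at x into the density at y. *)
Lemma ge0_integral_normal_affine (e : bool) (h : R) (f : R -> \bar R) :
  measurable_fun setT f -> (forall x, 0 <= f x)%E ->
  (\int[normal_prob 0 1]_x (f ((-1) ^+ e * x + h)%R *
     (expR ((x ^+ 2 - ((-1) ^+ e * x + h) ^+ 2) / 2))%:E)
   = \int[normal_prob 0 1]_x f x)%E.
Proof.
move=> mf f0.
pose F y := (f y * (normal_pdf 0 1 y)%:E)%E.
have mF : measurable_fun setT F.
  by apply: emeasurable_funM => //; apply/measurable_EFinP; exact: measurable_normal_pdf.
have F0 y : (0 <= F y)%E by rewrite mule_ge0// lee_fin normal_pdf_ge0.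
have mx : measurable_fun setT (fun x : R => (-1) ^+ e * x + h).
  by apply: measurable_funD => //; apply: measurable_funM.
rewrite !ge0_integral_normal_prob//; last 2 first.
- apply: emeasurable_funM; first exact: measurableT_comp mx.
  apply/measurable_EFinP/measurableT_comp => //.
  apply: measurable_funM => //; apply: measurable_funB; exact: measurable_funX.
- by move=> x; rewrite mule_ge0 // lee_fin expR_ge0.
transitivity (\int[leb]_x F ((-1) ^+ e * x + h)%R)%E.
  apply: eq_integral => x _; rewrite /F -muleA; congr (_ * _)%E.
  by rewrite -EFinM mulrC -normal_pdf01E.
rewrite -[RHS]/(\int[leb]_x F x)%E -(ge0_integral_shift h mF F0).
case: e {mx} => /=; last by under eq_integral do rewrite expr0 mul1r.
under eq_integral do rewrite expr1 mulN1r.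
apply: (ge0_integral_opp (f := fun x => F (x + h)%R)) => //.
by apply: measurableT_comp => //; exact: measurable_funD.
Qed.

End one_dim.

(** * The law of a Gaussian vector and an auxiliary variable *)

Section gspace.
Context {R : realType} {n : nat} {dA : measure_display} {Aux : measurableType dA}.

Definition rect (Bs : 'I_n -> set R) (C : set Aux) : set ('rV[R]_n * Aux) :=
  [set x : 'rV[R]_n * Aux | C x.2 /\ forall i, Bs i (x.1 0 i)].

Definition rects : set (set ('rV[R]_n * Aux)) :=
  [set E | exists Bs C, [/\ forall i, measurable (Bs i), measurable C & E = rect Bs C]].

Definition rvaux := ('rV[R]_n * Aux)%type.
HB.instance Definition _ := Choice.on rvaux.
HB.instance Definition _ := isPointed.Build rvaux (0, point).

(** The rectangles form a pi-system, and they are the sets whose probability [std_gauss_indep]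
    prescribes. A law on this space can therefore be identified on rectangles alone. *)
Definition gspace := g_sigma_algebraType (rects : set (set rvaux)).
HB.instance Definition _ := Measurable.on gspace.

Lemma rectsI : setI_closed rects.
Proof.
move=> _ _ [B1 [C1 [mB1 mC1 ->]]] [B2 [C2 [mB2 mC2 ->]]].
exists (fun i => B1 i `&` B2 i), (C1 `&` C2); split.
- by move=> i; exact: measurableI.
- exact: measurableI.
- apply/seteqP; split => x /=.
    by move=> [[c1 b1] [c2 b2]]; split; [split|move=> i; split; [exact: b1|exact: b2]].
  by move=> [[c1 c2] b]; split; split => // i; case: (b i).
Qed.

Lemma rectsT : rects setT.
Proof. by exists (fun=> setT), setT; split=> //; apply/seteqP; split. Qed.

Lemma measurable_rect Bs C : (forall i, measurable (Bs i)) -> measurable C ->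
  measurable (rect Bs C : set gspace).
Proof. by move=> mB mC; apply: sub_sigma_algebra; exists Bs, C. Qed.

Lemma measurable_coord (i : 'I_n) : measurable_fun setT (fun x : gspace => x.1 0 i).
Proof.
move=> _ B mB; rewrite setTI.
rewrite (_ : _ @^-1` _ = rect (fun j => if j == i then B else setT) setT).
  by apply: measurable_rect => // j; case: ifP.
apply/seteqP; split => x /=.
  by move=> Bx; split=> // j; case: eqP => // ->.
by move=> [_ /(_ i)]; rewrite eqxx.
Qed.

Lemma measurable_aux : measurable_fun setT (fun x : gspace => x.2).
Proof.
move=> _ C mC; rewrite setTI.
rewrite (_ : _ @^-1` _ = rect (fun=> setT) C); first exact: measurable_rect.
by apply/seteqP; split => x //= -[].
Qed.

Lemma measurable_gspace d (X : measurableType d) (f : X -> gspace) :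
  (forall i, measurable_fun setT (fun x => (f x).1 0 i)) ->
  measurable_fun setT (fun x => (f x).2) -> measurable_fun setT f.
Proof.
move=> m1 m2; apply: (@measurability _ _ X gspace setT f (rects : set (set gspace)) erefl) => _ [_ [Bs [C [mB mC ->]]] <-].
rewrite setTI.
rewrite (_ : _ @^-1` _ = (fun x => (f x).2) @^-1` C `&`
   \bigcap_(i in [set: 'I_n]) ((fun x => (f x).1 0 i) @^-1` Bs i)).
  apply: measurableI; first by rewrite -[X in measurable X]setTI; exact: m2.
  apply: fin_bigcap_measurable => // i _.
  by rewrite -[X in measurable X]setTI; exact: m1.
by apply/seteqP; split => x /= [c b]; split=> // i; [move=> _; exact: b|exact: b].
Qed.

Definition set_coord (i : 'I_n) (x : R) (s : gspace) : gspace :=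
  (\row_j (if j == i then x else s.1 0 j), s.2).

Lemma measurable_set_coord (i : 'I_n) :
  measurable_fun setT (fun p : measurableTypeR R * gspace => set_coord i p.1 p.2).
Proof.
apply: measurable_gspace => [j|] /=; last exact: measurableT_comp measurable_aux _.
under eq_fun do rewrite mxE.
case: eqP => _; first exact: measurable_fst.
exact: measurableT_comp (measurable_coord j) _.
Qed.

Variable mu : probability gspace R.
Hypothesis mu_gauss : forall Bs C, (forall i, measurable (Bs i)) -> measurable C ->
  mu (rect Bs C) = (mu (rect (fun=> setT) C) * \prod_(i < n) normal_prob 0 1 (Bs i))%E.

Let gamma : probability (measurableTypeR R) R := normal_prob (0 : R) 1.

(** Replacing coordinate [i] by a fresh standard Gaussian does not change the law: the two measures
    agree on rectangles, where coordinate [i] enters only through its own factor. *)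
Lemma resample_measure (i : 'I_n) (A : set gspace) : measurable A ->
  mu A = pushforward (gamma \x mu)%E (fun p : measurableTypeR R * gspace => set_coord i p.1 p.2 : gspace) A.
Proof.
have mu_ : measurable_fun setT (fun p : measurableTypeR R * gspace => set_coord i p.1 p.2 : gspace).
  exact: measurable_set_coord.
apply: (@measure_unique _ R gspace rects (fun=> setT) _ _ _ _ mu
  (pushforward (gamma \x mu)%E _)) => //.
- exact: rectsI.
- by move=> _; exact: rectsT.
- by apply/seteqP; split => // x _; exists 0%N.
- move=> _ [Bs [C [mB mC ->]]]; rewrite /pushforward.
  (* The constraint on coordinate [i] is moved to the fresh variable, and the old coordinate is left
     free. *)
  pose Bs' j := if j == i then setT else Bs j.
  have mB' j : measurable (Bs' j) by rewrite /Bs'; case: ifP.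
  rewrite [X in _ = (gamma \x mu)%E X](_ : _ = Bs i `*` (rect Bs' C : set gspace)).
    rewrite product_measure1E; [|exact: mB|exact: measurable_rect].
    apply: (eq_trans (mu_gauss mB mC)).
    transitivity (gamma (Bs i) * (mu (rect (fun=> setT) C) *
        \prod_(j < n) normal_prob 0 1 (Bs' j)))%E; last first.
      by congr (_ * _)%E; exact/esym/(mu_gauss mB' mC).
    rewrite (bigD1 i)//= [in RHS](bigD1 i)//=.
    have -> : normal_prob 0 1 (Bs' i) = 1%E.
      by rewrite /Bs' eqxx; exact: (@probability_setT _ _ _ gamma).
    rewrite mul1e muleCA; congr (_ * (_ * _))%E.
    by apply: eq_bigr => j /negbTE ji; rewrite /Bs' ji.
  apply/seteqP; split => -[x s] /=.
    move=> [c b]; split; first by have := b i; rewrite mxE eqxx.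
    by split => // j; have := b j; rewrite mxE /Bs'; case: eqP.
  move=> [bx [c b]]; split=> // j; rewrite mxE.
  by have := b j; rewrite /Bs'; case: eqP => // ->.
- by move=> _; apply: (le_lt_trans (probability_le1 mu _)) => //; exact: ltry.
Qed.

(** This reduces changes of variables in a single coordinate to one-dimensional integrals, with the
    other coordinates frozen. *)
Lemma resample (i : 'I_n) (f : gspace -> \bar R) :
  measurable_fun setT f -> (forall s, 0 <= f s)%E ->
  (\int[mu]_s f s = \int[mu]_s \int[normal_prob 0 1]_x f (set_coord i x s))%E.
Proof.
move=> mf f0.
have mu_ := measurable_set_coord i.
transitivity (\int[pushforward (gamma \x mu)%E (fun p : measurableTypeR R * gspace => set_coord i p.1 p.2 : gspace)]_s f s)%E.
  by apply: eq_measure_integral => A mA _; exact: resample_measure.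
rewrite ge0_integral_pushforward// preimage_setT.
rewrite fubini_tonelli2//.
  exact: measurableT_comp mu_.
by move=> x; exact: f0.
Qed.

End gspace.
Arguments gspace R n {dA} Aux.

(** * Changes of variables for Gaussian vectors *)

Section unimodular_maps.
Context {R : realType} {n : nat} {dA : measure_display} {Aux : measurableType dA}.
Notation S := (gspace R n Aux).
Variable mu : probability S R.
Hypothesis mu_gauss : forall (Bs : 'I_n -> set R) (C : set Aux),
  (forall i, measurable (Bs i)) -> measurable C ->
  mu (rect Bs C) = (mu (rect (fun=> setT) C) * \prod_(i < n) normal_prob 0 1 (Bs i))%E.

Definition nsq (z : 'rV[R]_n) : R := \sum_i z 0 i ^+ 2.

Definition gact (A : 'rV[R]_n -> 'rV[R]_n) (s : S) : S := (A s.1, s.2).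

(* The ratio at [A z] and [z] of the standard Gaussian densities. *)
Definition dratio (A : 'rV[R]_n -> 'rV[R]_n) (z : 'rV[R]_n) : R :=
  expR ((nsq z - nsq (A z)) / 2).

(* The change of variables formula for a map with Jacobian 1, with Lebesgue
   measure replaced by its density with respect to the law of the Gaussian. *)
Definition unimodular (A : 'rV[R]_n -> 'rV[R]_n) : Prop :=
  measurable_fun setT (gact A) /\
  forall f : S -> \bar R, measurable_fun setT f -> (forall s, 0 <= f s)%E ->
  (\int[mu]_s (f (gact A s) * (dratio A s.1)%:E) = \int[mu]_s f s)%E.

Lemma measurable_nsq : measurable_fun setT (fun s : S => nsq s.1).
Proof.
apply: (@measurable_sum _ _ _ _ _ _ (fun i (s : S) => s.1 0 i ^+ 2)) => i.
by apply: measurable_funX; exact: measurable_coord.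
Qed.

Lemma measurable_dratio A : measurable_fun setT (gact A) ->
  measurable_fun setT (fun s : S => dratio A s.1).
Proof.
move=> mA; apply: measurableT_comp => //; apply: measurable_funM => //.
apply: measurable_funB; first exact: measurable_nsq.
exact: (measurableT_comp measurable_nsq mA).
Qed.

(** The exponents of the two density ratios telescope through the intermediate point [B z]. *)
Lemma unimodular_comp A B : unimodular A -> unimodular B -> unimodular (A \o B).
Proof.
move=> [mA hA] [mB hB]; split; first exact: (measurableT_comp mA mB).
move=> f mf f0; apply: etrans (hA f mf f0).
apply: etrans (hB (fun s => f (gact A s) * (dratio A s.1)%:E)%E _ _).
- apply: eq_integral => s _; rewrite -muleA; congr (_ * _)%E.
  rewrite -EFinM; congr EFin; rewrite /dratio -expRD /=; congr expR; lra.
- apply: emeasurable_funM; first exact: measurableT_comp mf mA.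
  by apply/measurable_EFinP; exact: measurable_dratio.
- by move=> s; rewrite mule_ge0// lee_fin expR_ge0.
Qed.

Lemma unimodular_id : unimodular id.
Proof.
split.
  by apply: measurable_gspace => [i|]; [exact: measurable_coord|exact: measurable_aux].
move=> f _ _; apply: eq_integral => -[z u] _ /=.
by rewrite /dratio subrr mul0r expR0 mule1.
Qed.

Lemma eq_unimodular A B : A =1 B -> unimodular A -> unimodular B.
Proof. by move=> /funext ->. Qed.

Definition coord_map (i : 'I_n) (e : bool) (h : 'rV[R]_n -> R) (z : 'rV[R]_n) : 'rV[R]_n :=
  \row_j (if j == i then (-1) ^+ e * z 0 i + h z else z 0 j).

Lemma nsq_set_coord (i : 'I_n) x (s : S) :
  nsq (set_coord i x s).1 = x ^+ 2 + \sum_(j | j != i) s.1 0 j ^+ 2.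
Proof.
rewrite /nsq (bigD1 i)//= mxE eqxx; congr (_ + _).
by apply: eq_bigr => j /negbTE ji; rewrite mxE ji.
Qed.

(** As [h] does not depend on coordinate [i], it is a constant once the others are frozen. The map
    is then a one-dimensional affine map of slope ±1, handled by [ge0_integral_normal_affine]. *)
Lemma unimodular_coord_map i e (h : 'rV[R]_n -> R) :
  measurable_fun setT (fun s : S => h s.1) ->
  (forall z z' : 'rV[R]_n, (forall j, j != i -> z 0 j = z' 0 j) -> h z = h z') ->
  unimodular (coord_map i e h).
Proof.
move=> mh hi; have mA : measurable_fun setT (gact (coord_map i e h)).
  apply: measurable_gspace => [j|]; last exact: measurable_aux.
  rewrite /=; under eq_fun do rewrite mxE.
  case: eqP => _; last exact: measurable_coord.
  apply: measurable_funD => //; apply: measurable_funM => //.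
  exact: measurable_coord.
split=> // f mf f0.
apply: etrans (esym (resample mu_gauss i mf f0)).
apply: (etrans (resample mu_gauss i _ _)).
- apply: emeasurable_funM; first exact: measurableT_comp mf mA.
  by apply/measurable_EFinP; exact: measurable_dratio.
- by move=> s; rewrite mule_ge0// lee_fin expR_ge0.
apply: eq_integral => s _.
have hE x : h (set_coord i x s).1 = h s.1.
  by apply: hi => j /negbTE ji; rewrite mxE ji.
have uE x : gact (coord_map i e h) (set_coord i x s) = set_coord i ((-1) ^+ e * x + h s.1) s.
  rewrite /gact /set_coord /=; congr pair; apply/rowP => j; rewrite !mxE eqxx.
  by rewrite -[h _]/(h (set_coord i x s).1) hE; case: eqP.
pose g x := f (set_coord i x s).
have mg : measurable_fun setT g.
  apply: (measurableT_comp mf).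
  have /= := measurableT_comp (measurable_set_coord (Aux := Aux) i)
    (@pair2_measurable _ _ (measurableTypeR R) S s).
  exact.
apply: etrans (ge0_integral_normal_affine e (h s.1) mg (fun x => f0 _)).
apply: eq_integral => x _; rewrite uE; congr (_ * (expR _)%:E)%E.
rewrite -[coord_map _ _ _ _]/((gact (coord_map i e h) (set_coord i x s)).1) uE !nsq_set_coord.
lra.
Qed.

Lemma measurable_affine_form (c : 'I_n -> R) (P : pred 'I_n) (b : R) :
  measurable_fun setT (fun s : S => \sum_(l | P l) c l * s.1 0 l + b).
Proof.
apply: measurable_funD => //.
under eq_fun do rewrite big_mkcond /=.
apply: (@measurable_sum _ _ _ _ _ _ (fun i (s : S) => if P i then c i * s.1 0 i else 0)) => i.
case: (P i) => //.
by apply: measurable_funM => //; exact: measurable_coord.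
Qed.

Lemma unimodular_add_coord i (h : 'rV[R]_n -> R) :
  measurable_fun setT (fun s : S => h s.1) ->
  (forall z z' : 'rV[R]_n, (forall j, j != i -> z 0 j = z' 0 j) -> h z = h z') ->
  unimodular (fun z => z + h z *: delta_mx 0 i).
Proof.
move=> mh hi; apply: (eq_unimodular _ (unimodular_coord_map false mh hi)) => z.
apply/rowP => j; rewrite !mxE eqxx expr0 mul1r.
by case: eqP => [->|_] /=; rewrite ?mulr1 // mulr0 addr0.
Qed.

Lemma unimodular_translate (w : 'rV[R]_n) : unimodular (fun z => z + w).
Proof.
suff H (r : seq 'I_n) : unimodular (fun z => z + \sum_(j <- r) w 0 j *: delta_mx 0 j).
  by apply: eq_unimodular (H (index_enum _)) => z; rewrite -row_sum_delta.
elim: r => [|i r IH].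
  by apply: eq_unimodular unimodular_id => z; rewrite big_nil addr0.
have H := @unimodular_add_coord i (fun=> w 0 i) (measurable_cst _) (fun _ _ _ => erefl).
by apply: eq_unimodular (unimodular_comp H IH) => z /=; rewrite big_cons addrAC addrA.
Qed.

(** The shear is carried out one coordinate at a time; [v 0 i = 0] keeps the multiplier [z 0 i]
    unchanged on the way. *)
Lemma unimodular_shear (i : 'I_n) (v : 'rV[R]_n) : v 0 i = 0 ->
  unimodular (fun z => z + z 0 i *: v).
Proof.
move=> vi.
suff H (r : seq 'I_n) : unimodular (fun z => z + z 0 i *: \sum_(j <- r) v 0 j *: delta_mx 0 j).
  by apply: eq_unimodular (H (index_enum _)) => z; rewrite -row_sum_delta.
elim: r => [|j r IH].
  by apply: eq_unimodular unimodular_id => z; rewrite big_nil scaler0 addr0.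
have [->|ji] := eqVneq j i.
  by apply: eq_unimodular IH => z; rewrite big_cons vi scale0r add0r.
have m1 : measurable_fun setT (fun s : S => v 0 j * s.1 0 i).
  by apply: measurable_funM => //; exact: measurable_coord.
have H := @unimodular_add_coord j (fun z => v 0 j * z 0 i) m1.
apply: eq_unimodular (unimodular_comp IH (H _)) => [z|z z' zz']; last by rewrite zz' // eq_sym.
rewrite /= !mxE eqxx eq_sym (negbTE ji) mulr0 addr0 big_cons scalerDr addrA.
by rewrite scalerA mulrC.
Qed.

Definition dotr (z w : 'rV[R]_n) : R := \sum_l z 0 l * w 0 l.

Lemma nsq_gt0 (w : 'rV[R]_n) i : w 0 i != 0 -> 0 < nsq w.
Proof.
move=> wi; rewrite /nsq (bigD1 i)//= ltr_pwDl// ?exprn_even_gt0//.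
by apply: sumr_ge0 => j _; exact: sqr_ge0.
Qed.

Lemma nsqDZ (z w : 'rV[R]_n) c : nsq (z + c *: w) = nsq z + 2 * c * dotr z w + c ^+ 2 * nsq w.
Proof.
rewrite /nsq /dotr !mulr_sumr -!big_split /=; apply: eq_bigr => i _.
by rewrite !mxE; ring.
Qed.

Definition affine_refl (w : 'rV[R]_n) (b : R) (z : 'rV[R]_n) : 'rV[R]_n :=
  z - (2 * (dotr z w + b) / nsq w) *: w.

(* With a = z_i + (sum_(l != i) w_l z_l + b) / w_i, the reflection is the conjugate
   by the shear z_i |-> a of a |-> -a, z_l |-> z_l - 2 a w_i w_l / |w|^2, so that only
   maps changing one coordinate at a time are needed. *)
Lemma unimodular_affine_refl (w : 'rV[R]_n) (b : R) (i : 'I_n) : w 0 i != 0 -> unimodular (affine_refl w b).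
Proof.
move=> wi; have W0 := nsq_gt0 wi.
pose h (z : 'rV[R]_n) := \sum_(l | l != i) (w 0 l / w 0 i) * z 0 l + b / w 0 i.
pose v := \row_l (if l == i then 0 else - 2 * (w 0 i * w 0 l / nsq w)).
have hi (z z' : 'rV[R]_n) : (forall j, j != i -> z 0 j = z' 0 j) -> h z = h z'.
  by move=> zz'; congr (_ + _); apply: eq_bigr => j /zz' ->.
have mh : measurable_fun setT (fun s : S => h s.1) by exact: measurable_affine_form.
have n1 := unimodular_add_coord mh hi.
have mh' : measurable_fun setT (fun s : S => - h s.1) by exact: measurable_funN.
have n4 := @unimodular_add_coord i (fun z => - h z) mh' (fun z z' e => congr1 -%R (hi z z' e)).
have vi : v 0 i = 0 by rewrite mxE eqxx.
have n2 := unimodular_shear vi.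
have n3 := @unimodular_coord_map i true (fun=> 0) (measurable_cst _) (fun _ _ _ => erefl).
apply: eq_unimodular (unimodular_comp n4 (unimodular_comp n3 (unimodular_comp n2 n1))) => z.
have dE : dotr z w + b = w 0 i * (z 0 i + h z).
  rewrite /dotr /h (bigD1 i)//= mulrDr mulrDr mulr_sumr addrA mulrCA divff// mulr1.
  congr (_ + _ + _); first by rewrite mulrC.
  by apply: eq_bigr => j _; field.
have WE : \sum_(l | l != i) w 0 l ^+ 2 = nsq w - w 0 i ^+ 2.
  by rewrite /nsq [in RHS](bigD1 i)//= addrAC subrr add0r.
rewrite /=; set y1 := z + _; set y2 := y1 + _; set y3 := coord_map _ _ _ _.
have y1i : y1 0 i = z 0 i + h z by rewrite !mxE !eqxx mulr1.
have y1l l : l != i -> y1 0 l = z 0 l.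
  by move=> /negbTE li; rewrite !mxE eqxx li mulr0 addr0.
have y3i : y3 0 i = - (z 0 i + h z).
  by rewrite mxE eqxx expr1 addr0 [y2 0 i]mxE [X in _ + X]mxE vi mulr0 addr0 y1i mulN1r.
have y3l l : l != i -> y3 0 l = z 0 l - 2 * (dotr z w + b) / nsq w * w 0 l.
  move=> li; rewrite mxE (negbTE li) [y2 0 l]mxE [X in _ + X]mxE y1i y1l// mxE (negbTE li) dE.
  by field; rewrite gt_eqF.
(* The final shear subtracts [h] at the point already moved, not at [z], so its value there has to
   be computed. *)
have hy3 : h y3 = h z - 2 * (z 0 i + h z) * (nsq w - w 0 i ^+ 2) / nsq w.
  rewrite -WE {1}/h (eq_bigr (fun l => w 0 l / w 0 i * z 0 l
     - 2 * (z 0 i + h z) / nsq w * w 0 l ^+ 2)); last first.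
    move=> l li; rewrite y3l// dE; field; apply/andP; split; by [rewrite gt_eqF|].
  by rewrite sumrB -mulr_sumr -/(h z) addrAC -/(h z) mulrAC.
apply/rowP => l; rewrite [LHS]mxE [X in _ + X = _]mxE [delta_mx _ _ _ _]mxE eqxx /=.
rewrite [RHS]mxE [in RHS]mxE [in RHS]mxE.
have [->|li] := eqVneq l i; last by rewrite y3l//= mulr0 addr0.
rewrite /= mulr1 y3i hy3 dE; field; rewrite gt_eqF//.
Qed.

(** With t = 2 (z . w + b) / |w|^2, the difference |z|^2 - |z - t w|^2 = t (2 z . w - t |w|^2)
    collapses to -2 b t. *)
Lemma dratio_affine_refl (w : 'rV[R]_n) b z : 0 < nsq w ->
  dratio (affine_refl w b) z = expR (- (2 * b * (dotr z w + b) / nsq w)).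
Proof.
move=> W0; rewrite /dratio /affine_refl -scaleNr nsqDZ; congr expR; field; rewrite gt_eqF//.
Qed.

(** The density ratio of the translation z |-> z - w is exp(z . w - |w|^2 / 2), and its integral is
    1 by the change of variables applied to the constant function 1. *)
Lemma gauss_mgf (w : 'rV[R]_n) :
  (\int[mu]_s (expR (dotr s.1 w))%:E = (expR (nsq w / 2))%:E)%E.
Proof.
pose A (z : 'rV[R]_n) := z - w.
have [mA /(_ (cst 1)%E)] : unimodular A := unimodular_translate (- w).
move=> /(_ (measurable_cst _) (fun _ => lee01)) E.
have -> : (\int[mu]_s (expR (dotr s.1 w))%:E = (expR (nsq w / 2))%:E *
    \int[mu]_s (cst 1 (gact A s) * (dratio A s.1)%:E))%E.
  rewrite -ge0_integralZl//; first last.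
  - by move=> s _; rewrite mule_ge0// lee_fin expR_ge0.
  - by apply: emeasurable_funM => //; apply/measurable_EFinP; exact: measurable_dratio.
  apply: eq_integral => s _; rewrite mul1e -EFinM /dratio -expRD; congr (expR _)%:E.
  by rewrite /A -(scaleN1r w) nsqDZ; field.
rewrite E integral_cst// mul1e.
exact: etrans (congr1 _ (probability_setT mu)) (mule1 _).
Qed.

End unimodular_maps.

(** * Order statistics and the spectral bound *)

Section order_statistics.
Context {R : realType}.
Implicit Types (r : rel R) (s : seq R).

(** Only the first k - 1 entries can fail the comparison with the k-th one, ties included. A general
    [r] serves both the decreasing order of the [beta 0 i ^+ 2] and the increasing order of the
    squared eigenvector entries. *)
Lemma count_sorted_nth r s k : transitive r -> reflexive r -> sorted r s ->
  (0 < k <= size s)%N -> (count (fun x => ~~ r (nth 0%R s k.-1) x) s <= k.-1)%N.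
Proof.
move=> rt rr srt /andP[k0 ks]; set t := nth _ _ _.
have k1s : (k.-1 < size s)%N by rewrite prednK.
rewrite -[in leqLHS](cat_take_drop k.-1 s) count_cat (drop_nth 0%R k1s) -/t /=.
rewrite rr add0n.
have : path r t (drop k s).
  by have := drop_sorted k.-1 srt; rewrite (drop_nth 0%R k1s) prednK.
rewrite path_sortedE // => /andP[at_ _]; rewrite prednK//.
have -> : count (fun x => ~~ r t x) (drop k s) = 0%N.
  apply/eqP; rewrite -leqn0 leqNgt -has_count; apply/hasPn => x xs.
  by rewrite negbK; exact: (allP at_).
rewrite addn0; apply: leq_trans (count_size _ _) _.
by rewrite size_take k1s.
Qed.

Lemma card_sort_nth r d (f : 'I_d -> R) k : transitive r -> reflexive r -> total r ->
  (0 < k <= d)%N ->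
  (#|[pred i | ~~ r (nth 0%R (sort r [seq f i | i <- enum 'I_d]) k.-1) (f i)]| <= k.-1)%N.
Proof.
move=> rt rr rtot kd; set s := sort _ _.
have sz : size s = d by rewrite size_sort size_map size_enum_ord.
have := @count_sorted_nth r s k rt rr (sort_sorted rtot _).
rewrite sz => /(_ kd); apply: leq_trans.
rewrite cardE /enum_mem size_filter /s.
set t := nth _ _ _.
have /seq.permP -> : perm_eq (sort r [seq f i | i <- enum 'I_d]) [seq f i | i <- enum 'I_d].
  by rewrite perm_sort.
by rewrite [leqRHS]count_map enumT; apply: eq_leq; apply: eq_count => i.
Qed.

Lemma sum_take_sorted s k : sorted <=%R s -> (0 < k <= size s)%N ->
  \sum_(x <- take k s) x <= k%:R * nth 0 s k.-1.
Proof.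
move=> srt /andP[k0 ks].
rewrite (big_nth 0) size_takel// big_nat.
apply: le_trans (_ : \sum_(0 <= i < k) nth 0 s k.-1 <= _).
  rewrite [leRHS]big_nat; apply: ler_sum => i ik; rewrite nth_take//.
  apply: (sorted_leq_nth le_trans le_refl 0 srt); rewrite ?inE ?prednK//.
    exact: leq_trans ik ks.
  by rewrite -ltnS prednK.
by rewrite sumr_const_nat subn0 mulr_natl.
Qed.

End order_statistics.

Section spectral.
Context {R : realType} {d : nat}.
Variables (Sigma Delta Q : 'M[R]_d) (lam : 'I_d -> R).
Hypotheses (Spd : pd_mx Sigma) (Qo : Q^T *m Q = 1%:M)
  (eigQ : forall l, Sigma *m col l Q = lam l *: col l Q)
  (Dd : is_diag_mx Delta) (DS : psd_mx (Delta - Sigma)).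

Let q (M : 'M[R]_d) (v w : 'rV[R]_d) : R := (v *m M *m w^T) 0 0.

Let qB M N v w : q (M - N) v w = q M v w - q N v w.
Proof. by rewrite /q mulmxBr mulmxBl mxE [X in _ + X]mxE. Qed.

Let qBl M u v w : q M (u - v) w = q M u w - q M v w.
Proof. by rewrite /q !mulmxBl mxE [X in _ + X]mxE. Qed.

Let qBr M u v w : q M w (u - v) = q M w u - q M w v.
Proof. by rewrite /q linearB /= !mulmxBr mxE [X in _ + X]mxE. Qed.

Let qZl M a v w : q M (a *: v) w = a * q M v w.
Proof. by rewrite /q -!scalemxAl mxE. Qed.

Let qZr M a v w : q M v (a *: w) = a * q M v w.
Proof. by rewrite /q linearZ /= -scalemxAr mxE. Qed.

Lemma unit_pd_mx : Sigma \in unitmx.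
Proof.
case: Spd => _ pd; rewrite -row_free_unit -kermx_eq0; apply/rowV0P => v /sub_kermxP vS.
by apply/eqP; apply: contraT => /pd; rewrite vS mul0mx mxE ltxx.
Qed.

(** Testing [Delta - Sigma] on a basis vector bounds the diagonal of [Delta] below by that of
    [Sigma], which is positive. *)
Lemma diag_gt0 j : 0 < Delta j j.
Proof.
case: DS => _ /(_ (delta_mx 0 j)); rewrite -/(q _ _ _) qB subr_ge0.
case: Spd => _ /(_ (delta_mx 0 j)); rewrite -/(q _ _ _) => H1 H2.
have : q Delta (delta_mx 0 j) (delta_mx 0 j) = Delta j j.
  by rewrite /q -rowE trmx_delta -colE !mxE.
move=> <-; apply: lt_le_trans H2; apply: H1.
by apply/eqP => /rowP/(_ j)/eqP; rewrite !mxE !eqxx oner_eq0.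
Qed.

Lemma diag_quad (v : 'rV[R]_d) : q Delta v v = \sum_j Delta j j * v 0 j ^+ 2.
Proof.
rewrite /q mxE; apply: eq_bigr => j _; rewrite !mxE (bigD1 j)//= big1 ?addr0.
  by rewrite expr2 mulrA [v 0 j * _]mulrC.
by move=> i ij; rewrite (is_diag_mxP Dd) ?mulr0.
Qed.

(* Evaluate [Delta - Sigma] at v_j = u_j / Delta_jj, where
   v Sigma v^T >= lam (v . u)^2 by positivity of Sigma at v - (v . u) u. *)
Lemma eig_diag_le1 l : 0 < lam l /\ lam l * \sum_j (Q j l ^+ 2 / Delta j j) <= 1.
Proof.
set x := \sum_j _.
pose u := (col l Q)^T.
have uu : (u *m u^T) 0 0 = 1.
  transitivity ((Q^T *m Q) l l); last by rewrite Qo mxE eqxx.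
  by rewrite !mxE; apply: eq_bigr => i _; rewrite !mxE.
have Su : Sigma *m u^T = lam l *: u^T by rewrite trmxK.
have uS : u *m Sigma = lam l *: u.
  case: Spd => sS _; apply: trmx_inj.
  by rewrite trmx_mul sS Su [RHS]linearZ.
have quu : q Sigma u u = lam l by rewrite /q uS -scalemxAl mxE uu mulr1.
have u0 : u != 0 by apply: contra_eq_neq uu => ->; rewrite mul0mx mxE eq_sym oner_eq0.
have l0 : 0 < lam l by rewrite -quu; case: Spd => _; exact.
split=> //.
pose v := \row_j (Q j l / Delta j j).
have vu : (v *m u^T) 0 0 = x.
  by rewrite mxE; apply: eq_bigr => j _; rewrite !mxE expr2 mulrAC.
have uv : (u *m v^T) 0 0 = x.
  by rewrite mxE; apply: eq_bigr => j _; rewrite !mxE expr2 mulrA.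
have vDv : q Delta v v = x.
  rewrite diag_quad; apply: eq_bigr => j _; rewrite mxE.
  have := diag_gt0 j => /lt0r_neq0 D0; field; exact: D0.
have x0 : 0 <= x.
  by apply: sumr_ge0 => j _; rewrite mulr_ge0 ?sqr_ge0// invr_ge0 ltW// diag_gt0.
have psdS w : 0 <= q Sigma w w.
  have [->|w0] := eqVneq w 0; first by rewrite /q mul0mx mul0mx mxE.
  by apply: ltW; case: Spd => _; exact.
have vSv : lam l * x ^+ 2 <= q Sigma v v.
  have := psdS (v - x *: u).
  have -> : q Sigma (v - x *: u) (v - x *: u) = q Sigma v v - lam l * x ^+ 2.
    rewrite qBl !qBr !qZl !qZr quu.
    have -> : q Sigma u v = lam l * x by rewrite /q uS -scalemxAl mxE uv.
    have -> : q Sigma v u = lam l * x by rewrite /q -mulmxA Su -scalemxAr mxE vu.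
    ring.
  by rewrite subr_ge0.
have : lam l * x ^+ 2 <= x.
  case: DS => _ /(_ v); rewrite -/(q _ _ _) qB subr_ge0 vDv; exact: le_trans.
rewrite le_eqVlt in x0; case/orP: x0 => [/eqP <-|x0]; first by rewrite mulr0.
by rewrite expr2 mulrA -[leRHS]mul1r ler_pM2r.
Qed.

End spectral.

(** * Coordinates of small total signal-to-noise ratio *)

Section good_coordinates.
Context {R : realType} {d : nat}.

(** [G] keeps the indices whose [beta] entry is at most the k-th largest in square and whose entry
    of the critical eigenvector is at least the k-th smallest in square. Each requirement discards
    at most k - 1 indices. *)
Lemma good_coordinates (alpha sigma2 : R) (Sigma Delta Q : 'M[R]_d)
    (lam : 'I_d -> R) (beta : 'rV[R]_d) (k : nat) :
  0 < alpha < 1 -> 0 < sigma2 ->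
  pd_mx Sigma -> Q^T *m Q = 1%:M ->
  (forall l, Sigma *m col l Q = lam l *: col l Q) ->
  is_diag_mx Delta -> psd_mx (Delta - Sigma) ->
  (1 <= k <= d)%N -> k_cond alpha sigma2 beta Q lam k ->
  exists G : pred 'I_d, (#|[predC G]| <= 2 * k)%N /\
    \sum_(j | G j) (2 * beta 0 j ^+ 2 / (sigma2 * Delta j j)) <= - ln alpha / 2 * k%:R.
Proof.
move=> /andP[a0 a1] s0 Spd Qo eigQ Dd DS kd kc.
pose L := - ln alpha / 2.
have L0 : 0 < L by rewrite divr_gt0// oppr_gt0 ln_lt0// a0.
pose bk := beta_ord2 beta k.
pose srt l := sort (fun x y : R => x <= y) [seq Q i l ^+ 2 | i <- enum 'I_d].
have bk0 : 0 <= bk.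
  rewrite /bk /beta_ord2; set s := sort _ _.
  have [ks|ks] := ltnP k.-1 (size s); last by rewrite nth_default.
  have : nth 0 s k.-1 \in s by exact: mem_nth.
  by rewrite mem_sort => /mapP[i _ ->]; exact: sqr_ge0.
(* If every [l] failed, so would the maximum [b_k]; its default value 0 causes no trouble because
   [bk] is nonnegative. *)
have [l hl] : exists l, 2 * bk < L * sigma2 * (lam l * \sum_(x <- take k (srt l)) x).
  apply/not_existsP => H; move: kc; rewrite /k_cond -/bk; apply/negP; rewrite -leNgt.
  have -> : - (1 / 2) * ln alpha * (sigma2 * b_k Q lam k) = L * sigma2 * b_k Q lam k.
    by rewrite /L; field.
  have c0 : 0 < L * sigma2 by rewrite mulr_gt0.
  rewrite mulrC -ler_pdivlMr//; apply: bigmax_le.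
    by apply: divr_ge0; [exact: mulr_ge0|exact: ltW].
  move=> l _; rewrite ler_pdivlMr// mulrC leNgt; apply/negP; exact: H.
have [l0 lD] := eig_diag_le1 Spd Qo eigQ Dd DS l.
pose tau := nth 0 (srt l) k.-1.
have le_tot : total (fun x y : R => x <= y) by exact: le_total.
have szl : size (srt l) = d by rewrite size_sort size_map size_enum_ord.
have sumtau : \sum_(x <- take k (srt l)) x <= k%:R * tau.
  by apply: sum_take_sorted; rewrite ?szl//; exact: sort_sorted.
have rt : transitive (fun x y : R => y <= x) by move=> x y z xy zx; exact: le_trans zx xy.
pose ge : rel R := fun x y => y <= x.
exists [pred j | (beta 0 j ^+ 2 <= bk) && (tau <= Q j l ^+ 2)]; split.
  apply: (@leq_trans (#|[pred i | ~~ ge bk (beta 0 i ^+ 2)]|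
     + #|[pred i | ~~ (tau <= Q i l ^+ 2)]|)); last first.
    rewrite mul2n -addnn; apply: leq_add.
      apply: leq_trans (leq_pred k).
      exact: (@card_sort_nth R ge d (fun i => beta 0 i ^+ 2) k rt lexx
        (fun x y => le_total y x) kd).
    apply: leq_trans (leq_pred k).
    exact: (@card_sort_nth R (fun x y => x <= y) d (fun i => Q i l ^+ 2) k le_trans lexx
      le_tot kd).
  rewrite -cardUI; apply: leq_trans (leq_addr _ _).
  by apply: subset_leq_card; apply/fintype.subsetP => j; rewrite !inE negb_and.
have D0 := diag_gt0 Spd DS.
(* The bound holds term by term on [G]; extending it to all indices adds nonnegative terms, and
   [eig_diag_le1] caps the full sum. *)
apply: (@le_trans _ _ (\sum_j (L * k%:R * (lam l * (Q j l ^+ 2 / Delta j j))))).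
  rewrite [leRHS](bigID [pred j | (beta 0 j ^+ 2 <= bk) && (tau <= Q j l ^+ 2)])/=.
  rewrite -[leLHS]addr0; apply: lerD; last first.
    apply: sumr_ge0 => j _; apply: mulr_ge0; first by rewrite mulr_ge0// ltW.
    by rewrite mulr_ge0 ?(ltW l0)// divr_ge0 ?sqr_ge0// ltW.
  apply: ler_sum => j /andP[bj tj].
  rewrite ler_pdivrMr ?mulr_gt0//.
  have -> : L * k%:R * (lam l * (Q j l ^+ 2 / Delta j j)) * (sigma2 * Delta j j)
     = L * sigma2 * (lam l * (k%:R * Q j l ^+ 2)).
    by field; exact: lt0r_neq0.
  apply: le_trans (_ : 2 * bk <= _); first by rewrite ler_pM2l.
  apply: (le_trans (ltW hl)); apply: ler_wpM2l; first by rewrite ltW// mulr_gt0.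
  apply: ler_wpM2l; first exact: ltW.
  by apply: (le_trans sumtau); exact: ler_wpM2l.
rewrite -mulr_sumr -mulr_sumr -[leRHS]mulr1 ler_wpM2l// mulr_ge0// ltW//.
Qed.

End good_coordinates.

(** * The number of rejections *)

Section rejections.
Context {R : realType} {d : nat}.

Definition walk_weight (eta c : R) (h : bool) : R := expR (if h then eta else - (eta * c)).

(** The sum over times of exp(eta * walk), where the walk moves by +1 or -c and skips the indices in
    [G]. Restricting the times to steps outside [G] makes the number of factors grow by one from
    term to term, so that expectations decay geometrically. *)
Definition walk_sum (eta c : R) (s : {perm 'I_d}) (h G : pred 'I_d) : R :=
  \sum_(t < d | ~~ G (s t)) \prod_(j < d | (j <= t)%N && ~~ G (s j)) walk_weight eta c (h (s j)).

Lemma walk_sum_ge0 eta c s h G : 0 <= walk_sum eta c s h G.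
Proof. by apply: sumr_ge0 => t _; apply: prodr_ge0 => j _; exact: expR_ge0. Qed.

(* [walk_sum] dominates the maximum over time of the walk: at the last index
   before [k] outside [G] the walk has the same value as at [k], and x <= e^(eta x) / eta. *)
Lemma walk_le (eta c : R) (s : {perm 'I_d}) (h G : pred 'I_d) (k : nat) : 0 < eta ->
  \sum_(j < d | (j < k)%N && ~~ G (s j)) (if h (s j) then 1 else - c)
    <= walk_sum eta c s h G / eta.
Proof.
move=> e0; set A := fun j : 'I_d => (j < k)%N && ~~ G (s j).
have [/existsP[t0 At0]|/existsPn A0] := boolP [exists j, A j]; last first.
  rewrite big_pred0; first by rewrite divr_ge0 ?walk_sum_ge0// ltW.
  by move=> j; apply/negbTE; exact: A0.
case: (arg_maxnP (fun t : 'I_d => t : nat) At0) => t /andP[tk Gt] tmax.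
have AE : A =1 (fun j => (j <= t)%N && ~~ G (s j)).
  move=> j; apply/idP/idP; first by move=> Aj; apply/andP; split; [exact: (tmax j Aj)|case/andP: Aj].
  by move=> /andP[jt Gj]; rewrite /A Gj andbT (leq_ltn_trans jt tk).
rewrite (eq_bigl _ _ AE); set X := \sum_(_ | _) _.
rewrite ler_pdivlMr// mulrC; apply: le_trans (_ : expR (eta * X) <= _).
  by apply: le_trans (expR_ge1Dx _); rewrite lerDr.
rewrite /X mulr_sumr expR_sum /walk_sum [leRHS](bigD1 t)//=.
rewrite -[leLHS]addr0; apply: lerD; last first.
  by apply: sumr_ge0 => i _; apply: prodr_ge0 => j _; exact: expR_ge0.
rewrite le_eqVlt; apply/orP; left; apply/eqP; apply: eq_bigr => j _; rewrite /walk_weight.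
by case: ifP => _; rewrite ?mulr1 ?mulrN.
Qed.

Lemma n_halfE (bt : 'rV[R]_d) s psi k :
  (n_half bt s psi k)%:R = \sum_(j < d | (j < k)%N && phalf bt psi (s j)) 1 :> R.
Proof.
rewrite /n_half -sum1_card natr_sum; apply: eq_bigl => j.
by apply/idP/idP => [/set_mem|/mem_set].
Qed.

Lemma n_oneE (bt : 'rV[R]_d) s psi k :
  (n_one bt s psi k)%:R = \sum_(j < d | (j < k)%N && ~~ phalf bt psi (s j)) 1 :> R.
Proof.
rewrite /n_one -sum1_card natr_sum; apply: eq_bigl => j.
by apply/idP/idP => [/set_mem|/mem_set].
Qed.

Lemma khatP (alpha : R) (bt : 'rV[R]_d) s psi :
  khat alpha bt s psi = 0%N \/ fdp_le alpha bt s psi (khat alpha bt s psi).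
Proof.
pose P (k : 'I_d.+1) := (1 <= k)%N && fdp_le alpha bt s psi k; rewrite /khat -/P.
have [/card0_eq P0|Ppos] := posnP #|P|.
  by left; rewrite big_pred0//; exact: P0.
right; have [k kP ->] := eq_bigmax_cond (fun k : 'I_d.+1 => k : nat) Ppos.
by move: kP; rewrite unfold_in => /andP[].
Qed.

(** Let N and M count p~ = 1/2 and p~ = 1 outside [G] up to [khat], and let g be the size of [G].
    The stopping rule gives c M <= a (g + N), while the walk gives N - c M <= [walk_sum] / eta.
    Together they bound (1 - a) N, and there are at most g + N rejections. *)
Lemma n_rej_le (alpha a c eta : R) (bt : 'rV[R]_d) s psi (G : pred 'I_d) :
  0 < eta -> 0 < a < 1 -> 0 < c -> c * alpha = a ->
  (n_rej alpha bt s psi)%:R <= (1 + (1 - a)^-1) * #|G|%:R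
     + walk_sum eta c s (phalf bt psi) G / eta / (1 - a).
Proof.
move=> e0 /andP[a0 a1] c0 ca; rewrite /n_rej.
set k := khat _ _ _ _; have := khatP alpha bt s psi; rewrite -/k.
have F0 := walk_sum_ge0 eta c s (phalf bt psi) G.
have a1' : 0 < 1 - a by rewrite subr_gt0.
have rhs0 : 0 <= (1 + (1 - a)^-1) * #|G|%:R + walk_sum eta c s (phalf bt psi) G / eta / (1 - a).
  by rewrite addr_ge0// ?mulr_ge0// ?addr_ge0// ?invr_ge0 ?ltW.
case=> [k0|/andP[h0 hle]].
  by rewrite k0 n_halfE big_pred0.
have h0' : 0 < (n_half bt s psi k)%:R :> R by rewrite ltr0n.
move: hle; rewrite ler_pdivrMr// natrD => hle.
set F := walk_sum _ _ _ _ _ in F0 rhs0 *.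
pose N : R := \sum_(j < d | (j < k)%N && ~~ G (s j)) (phalf bt psi (s j))%:R.
pose M : R := \sum_(j < d | (j < k)%N && ~~ G (s j)) (~~ phalf bt psi (s j))%:R.
have NM : N - c * M <= F / eta.
  apply: le_trans (walk_le c s (phalf bt psi) G k e0).
  rewrite /N /M mulr_sumr -sumrB; apply: ler_sum => j _.
  by case: (phalf _ _ _) => /=; rewrite ?mulr0 ?mulr1 ?subr0 ?sub0r.
have MO : M <= (n_one bt s psi k)%:R.
  rewrite n_oneE /M big_mkcond [leRHS]big_mkcond /=; apply: ler_sum => j _.
  by case: (_ < _)%N => //=; case: (phalf _ _ _); case: (G _).
have HN : (n_half bt s psi k)%:R <= #|G|%:R + N.
  have -> : #|G|%:R = \sum_(j < d) (G (s j))%:R :> R.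
    transitivity (\sum_(j < d) (G j)%:R : R); last by rewrite (reindex_perm s).
    by rewrite -sum1_card natr_sum big_mkcond; apply: eq_bigr => j _; rewrite unfold_in; case: (G j).
  rewrite n_halfE /N [leLHS]big_mkcond [X in _ <= _ + X]big_mkcond -big_split /=; apply: ler_sum => j _.
  by case: (_ < _)%N => //=; case: (phalf _ _ _); case: (G _) => //=; rewrite ?addr0 ?add0r ?lerDl.
have G0 : 0 <= #|G|%:R :> R by [].
have a0' : 0 < alpha by rewrite -(pmulr_rgt0 _ c0) ca.
set g : R := #|G|%:R in HN G0 rhs0 *; set H : R := (n_half _ _ _ _)%:R in HN hle h0' *.
set O : R := (n_one _ _ _ _)%:R in MO hle.
have cM : c * M <= a * (g + N).
  rewrite -ca -mulrA; apply: ler_wpM2l; first exact: ltW.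
  apply: (le_trans MO); apply: le_trans (_ : alpha * H <= _); first lra.
  by apply: ler_wpM2l; first exact: ltW.
have : (1 - a) * N <= F / eta + g by nra.
rewrite -ler_pdivlMl// => NN.
apply: (le_trans HN); apply: le_trans (lerD (lexx g) NN) _.
by rewrite le_eqVlt; apply/orP; left; apply/eqP; field; apply/andP; split; exact: lt0r_neq0.
Qed.

End rejections.

(** * Exponential moment of one step, and geometric sums *)

Section constants.
Context {R : realType}.

(** At odds [theta] the step +1 or -c has negative drift, so its exponential moment is below 1 for a
    small positive [eta]. The estimates e^x <= 1 / (1 - x) and e^(-y) <= 1 / (1 + y) reduce this to
    a rational inequality. *)
Lemma exists_eta (theta c : R) : 0 < theta < c -> exists2 eta, 0 < eta &
  expR eta * theta + expR (- (eta * c)) < theta + 1.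
Proof.
move=> /andP[t0 tc]; have c0 := lt_trans t0 tc.
(* The sign is decided by (c - theta) - eta c (theta + 1), which this choice makes equal to (c -
   theta) / 2. *)
pose eta := (c - theta) / (2 * c * (theta + 1)).
have D0 : 0 < 2 * c * (theta + 1) by rewrite !mulr_gt0// addr_gt0.
have e0 : 0 < eta by rewrite divr_gt0// subr_gt0.
have eE : eta * (2 * c * (theta + 1)) = c - theta by rewrite divfK// gt_eqF.
have e1 : eta < 1 by rewrite ltr_pdivrMr// mul1r; nra.
have ec0 : 0 < eta * c by rewrite mulr_gt0.
exists eta => //.
have E1 : expR eta <= (1 - eta)^-1.
  have := expR_ge1Dx (- eta); rewrite expRN => H.
  by rewrite -[expR eta]invrK lef_pV2// ?posrE ?invr_gt0 ?expR_gt0// subr_gt0.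
have E2 : expR (- (eta * c)) <= (1 + eta * c)^-1.
  rewrite expRN lef_pV2 ?posrE ?expR_gt0 ?expR_ge1Dx// addr_gt0//.
apply: le_lt_trans (lerD (ler_wpM2r (ltW t0) E1) E2) _.
have d1 : 0 < 1 - eta by rewrite subr_gt0.
have d2 : 0 < 1 + eta * c by rewrite addr_gt0.
rewrite -subr_gt0.
have -> : theta + 1 - ((1 - eta)^-1 * theta + (1 + eta * c)^-1) =
   eta * (c * (1 - eta) - theta * (1 + eta * c)) / ((1 - eta) * (1 + eta * c)).
  by field; rewrite !gt_eqF.
rewrite divr_gt0// mulr_gt0//; nra.
Qed.

(** Each index satisfying [b] contributes the next power of [rho], starting from the first, so this
    is a finite geometric sum. *)
Lemma sum_geom_count_nat (rho : R) (b : pred nat) (n : nat) :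
  (1 - rho) * (\sum_(t < n | b t) rho ^+ (\sum_(j < t.+1) b j)) =
  rho - rho ^+ (\sum_(j < n) b j).+1.
Proof.
elim: n => [|n IH]; first by rewrite !big_ord0 mulr0 expr1 subrr.
rewrite [in LHS]big_mkcond big_ord_recr /= -big_mkcond mulrDr IH big_ord_recr /=.
case: (b n) => /=; last by rewrite mulr0 addr0 addn0.
by rewrite addn1 !exprS; ring.
Qed.

Lemma sum_geom_count (rho : R) d (b : pred 'I_d) : 0 <= rho < 1 ->
  \sum_(t < d | b t) rho ^+ #|[pred j : 'I_d | (j <= t)%N && b j]| <= (1 - rho)^-1.
Proof.
move=> /andP[r0 r1].
(* The predicate is extended by [false] beyond [d] so that the induction over natural numbers
   applies. *)
pose bn i := if insub i is Some j then b j else false.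
have bnE (j : 'I_d) : bn j = b j by rewrite /bn valK.
have r1' : 0 < 1 - rho by rewrite subr_gt0.
have -> : \sum_(t < d | b t) rho ^+ #|[pred j : 'I_d | (j <= t)%N && b j]| =
   \sum_(t < d | bn t) rho ^+ (\sum_(j < t.+1) bn j).
  apply: eq_big => t; first by rewrite bnE.
  move=> _; congr (_ ^+ _); rewrite (big_ord_widen d (fun j => bn j : nat))//.
  rewrite -sum1_card big_mkcond [RHS]big_mkcond; apply: eq_bigr => j _.
  by rewrite inE ltnS bnE; case: (_ <= _)%N => //=; case: (b j).
rewrite -(ler_pM2l r1') sum_geom_count_nat divff ?gt_eqF//.
by apply: le_trans (ltW r1); rewrite lerBlDr lerDl exprn_ge0.
Qed.

End constants.

(** * Sign flips *)

Section flips.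
Context {R : realType} {d : nat}.
Variables (sigma2 : R) (beta : 'rV[R]_d) (Sigma Delta A B : 'M[R]_d).
Hypotheses (s0 : 0 < sigma2) (Spd : pd_mx Sigma) (Dd : is_diag_mx Delta)
  (DS : psd_mx (Delta - Sigma)) (AA : A *m A^T = Sigma) (BB : B *m B^T = Delta - Sigma).
Implicit Type z : 'rV[R]_(d + d).

Let sg := Num.sqrt sigma2.
Let sg0 : 0 < sg. Proof. by rewrite sqrtr_gt0. Qed.
Let D0 j : 0 < Delta j j. Proof. exact: diag_gt0 Spd DS j. Qed.

Definition bhat z : 'rV[R]_d := beta + sg *: (lsubmx z *m A^T).
Definition btil z : 'rV[R]_d := bhat z + sg *: (rsubmx z *m B^T).
Definition xi z : 'rV[R]_d := bhat z *m invmx Sigma - btil z *m invmx Delta.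

Definition wrow j : 'rV[R]_(d + d) := row j (row_mx A B).

Lemma btilE z : btil z = beta + sg *: (z *m (row_mx A B)^T).
Proof.
rewrite /btil /bhat -addrA -scalerDr; congr (_ + _ *: _).
by rewrite tr_row_mx -[in RHS](hsubmxK z) mul_row_col.
Qed.

Lemma btil_dotr z j : btil z 0 j = beta 0 j + sg * dotr z (wrow j).
Proof.
rewrite btilE mxE [X in _ + X]mxE; congr (_ + _ * _).
by rewrite mxE; apply: eq_bigr => i _; rewrite [_^T _ _]mxE [wrow _ _ _]mxE.
Qed.

(** The rows [wrow j] have Gram matrix [Delta]. Since [Delta] is diagonal they are orthogonal, and
    reflecting along one of them leaves the other coordinates of [btil] alone. *)
Lemma wrow_wrow : row_mx A B *m (row_mx A B)^T = Delta.
Proof. by rewrite tr_row_mx mul_row_col AA BB addrC subrK. Qed.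

Lemma nsq_wrow j : nsq (wrow j) = Delta j j.
Proof.
rewrite -wrow_wrow mxE; apply: eq_bigr => i _.
by rewrite [_^T _ _]mxE [wrow _ _ _]mxE expr2.
Qed.

(** The offset is chosen so that the mirror is the hyperplane where coordinate [j] of [btil]
    vanishes. *)
Definition flip j := affine_refl (wrow j) (beta 0 j / sg).

Lemma flipE j z : flip j z = z - (2 * btil z 0 j / (sg * Delta j j)) *: wrow j.
Proof.
rewrite /flip /affine_refl nsq_wrow btil_dotr; congr (_ - _ *: _).
by field; rewrite !gt_eqF.
Qed.

Lemma row_diag j : row j Delta = Delta j j *: delta_mx 0 j.
Proof.
apply/rowP => i; rewrite !mxE eqxx; have [->|ij] := eqVneq i j; first by rewrite mulr1.
by rewrite (is_diag_mxP Dd) ?mulr0// eq_sym.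
Qed.

Lemma btil_flip j z : btil (flip j z) = btil z - (2 * btil z 0 j) *: delta_mx 0 j.
Proof.
rewrite [LHS]btilE flipE mulmxBl -scalemxAl -row_mul wrow_wrow row_diag.
rewrite scalerBr addrA -btilE !scalerA; congr (_ - _ *: _).
by field; rewrite !gt_eqF.
Qed.

Lemma norm_btil_flip j z : map_mx Num.norm (btil (flip j z)) = map_mx Num.norm (btil z).
Proof.
apply/rowP => i; rewrite btil_flip !mxE eqxx.
have [->|ij] := eqVneq i j; last by rewrite mulr0 subr0.
by rewrite mulr1 mulr_natl mulr2n opprD addrA subrr add0r normrN.
Qed.

(** The flip moves [bhat] along row [j] of [Sigma] and [btil] along the j-th basis vector. After
    multiplication by the two inverses, both changes are the same multiple of that basis vector and
    cancel. *)
Lemma xi_flip j z : xi (flip j z) = xi z.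
Proof.
have SU := unit_pd_mx Spd.
have DU : Delta \in unitmx.
  by rewrite unitmxE det_trig ?is_diag_mx_is_trig// unitfE; apply/prodf_neq0 => i _; rewrite gt_eqF.
have bh : bhat (flip j z) = bhat z - (2 * btil z 0 j / Delta j j) *: row j Sigma.
  rewrite /bhat flipE linearB linearZ /= mulmxBl -scalemxAl.
  rewrite /wrow row_row_mx row_mxKl -row_mul AA scalerBr addrA scalerA; congr (_ - _ *: _).
  by field; rewrite !gt_eqF.
rewrite /xi bh btil_flip !mulmxBl -!scalemxAl -row_mul mulmxV// row1.
have -> : (delta_mx 0 j : 'rV[R]_d) *m invmx Delta = (Delta j j)^-1 *: delta_mx 0 j.
  rewrite -[RHS](mulmxK DU) -scalemxAl -(rowE j Delta) row_diag.
  by rewrite scalerA mulVf ?gt_eqF// scale1r.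
by rewrite scalerA opprB addrA subrK.
Qed.

Lemma dratio_flip j z :
  dratio (flip j) z = expR (- (2 * beta 0 j * btil z 0 j / (sigma2 * Delta j j))).
Proof.
rewrite /flip dratio_affine_refl ?nsq_wrow// btil_dotr -[in RHS](sqr_sqrtr (ltW s0)) -/sg.
by congr expR; field; rewrite !gt_eqF.
Qed.

Lemma wrow_neq0 j : exists i, wrow j 0 i != 0.
Proof.
apply/existsP; apply: contraT; rewrite negb_exists => /forallP w0.
have := D0 j; rewrite -nsq_wrow /nsq big1 ?ltxx// => i _.
by move: (w0 i); rewrite negbK => /eqP ->; rewrite expr0n.
Qed.

End flips.

(** * Measurability of boolean functions and of linear images *)

Section measurability_bool.
Context {R : realType} {dS : measure_display} {S : measurableType dS}.

Lemma measurable_fun_of_bool (f : S -> bool) (g : bool -> R) :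
  measurable_fun setT f -> measurable_fun setT (fun s => g (f s)).
Proof. by move=> mf; apply: (measurableT_comp _ mf) => _ B _. Qed.

Lemma measurable_mulmx m p (f : S -> 'rV[R]_m) (M : 'M[R]_(m, p)) :
  (forall i, measurable_fun setT (fun s => f s 0 i)) ->
  forall i, measurable_fun setT (fun s => (f s *m M) 0 i).
Proof.
move=> mf i; under eq_fun do rewrite mxE.
apply: (@measurable_sum _ _ _ _ _ _ (fun k s => f s 0 k * M k i)) => k.
exact: measurable_funM.
Qed.

End measurability_bool.

(** [rho] is the mean of [E] and [w] at odds [th]; lowering the odds of the larger value [E] can
    only lower the mean. The terms are arranged so that no extended reals are subtracted. *)
Lemma odds_step {R : realType} (p q : \bar R) (th E w rho : R) :
  (0 <= p -> 0 <= q -> p <= th%:E * q -> ((E - rho) * th)%R = (rho - w)%R ->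
  (rho <= E)%R -> (0 <= w)%R -> (w <= rho)%R ->
  E%:E * p + w%:E * q <= rho%:E * (p + q))%E.
Proof.
move=> p0 q0 pq Er rE w0 wr.
have r0 : 0 <= rho by exact: le_trans w0 wr.
have -> : (E%:E * p = rho%:E * p + (E - rho)%:E * p)%E.
  by rewrite -ge0_muleDl ?lee_fin ?subr_ge0// -EFinD addrC subrK.
have -> : (rho%:E * (p + q) = rho%:E * p + ((rho - w)%:E * q + w%:E * q))%E.
  by rewrite ge0_muleDr// -[in RHS]ge0_muleDl ?lee_fin ?subr_ge0// -EFinD subrK.
rewrite -addeA; apply: leeD => //; apply: leeD => //.
by rewrite -Er EFinM -muleA; apply: lee_wpmul2l => //; rewrite lee_fin subr_ge0.
Qed.

(** * Expectations *)

Section core.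
Context {R : realType} {d : nat} {dA : measure_display} {Aux : measurableType dA}.
Notation S := (gspace R (d + d) Aux).
Variables (alpha sigma2 : R) (beta : 'rV[R]_d) (Sigma Delta A B : 'M[R]_d).
Hypotheses (s0 : 0 < sigma2) (Spd : pd_mx Sigma) (Dd : is_diag_mx Delta)
  (DS : psd_mx (Delta - Sigma)) (AA : A *m A^T = Sigma) (BB : B *m B^T = Delta - Sigma).
Variable rule : 'rV[R]_d -> 'rV[R]_d -> Aux -> {perm 'I_d} * {ffun 'I_d -> bool}.
Hypothesis mrule : rule_measurable rule.

Variable mu : probability S R.
Hypothesis mu_gauss : forall (Bs : 'I_(d + d) -> set R) (C : set Aux),
  (forall i, measurable (Bs i)) -> measurable C ->
  mu (rect Bs C) =
    (mu (rect (fun=> setT) C) * \prod_(i < d + d) normal_prob 0 1 (Bs i))%E.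

Local Notation bt s := (btil sigma2 beta A B s.1).
Local Notation xis s := (xi sigma2 beta Sigma Delta A B s.1).
Local Notation flp j := (flip sigma2 beta A B j).

Definition out (s : S) := rule (xis s) (map_mx Num.norm (bt s)) s.2.

Lemma measurable_bhat i : measurable_fun setT (fun s : S => bhat sigma2 beta A s.1 0 i).
Proof.
rewrite /bhat; under eq_fun do rewrite mxE [X in _ + X]mxE.
apply: measurable_funD => //; apply: measurable_funM => //.
apply: measurable_mulmx => k; under eq_fun do rewrite mxE; exact: measurable_coord.
Qed.

Lemma measurable_btil i : measurable_fun setT (fun s : S => bt s 0 i).
Proof.
rewrite /btil; under eq_fun do rewrite mxE [X in _ + X]mxE.
apply: measurable_funD; first exact: measurable_bhat.
apply: measurable_funM => //.
apply: measurable_mulmx => k; under eq_fun do rewrite mxE; exact: measurable_coord.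
Qed.

Lemma measurable_xi i : measurable_fun setT (fun s : S => xis s 0 i).
Proof.
rewrite /xi; under eq_fun do rewrite mxE [X in _ + X]mxE.
apply: measurable_funB; apply: measurable_mulmx => k.
  exact: measurable_bhat.
exact: measurable_btil.
Qed.

Lemma measurable_out o : measurable [set s : S | out s = o].
Proof.
pose f (s : S) := (xis s, map_mx Num.norm (bt s), s.2).
(* The sets with measurable preimage form a sigma-algebra, so only cylinders have to be checked. *)
have H : <<s @input_cylinders R d dA Aux >> `<=` [set E | measurable (f @^-1` E : set S)].
  apply: smallest_sub.
    split => /=.
    - by rewrite preimage_set0.
    - by move=> E mE; rewrite setTD preimage_setC; exact: measurableC.
    - by move=> F mF; rewrite preimage_bigcup; exact: bigcup_measurable.
  move=> E [|[]] [].
  - move=> i [Bs [mB ->]] /=; rewrite -[X in measurable X]setTI.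
    exact: (measurable_xi i measurableT mB).
  - move=> i [Bs [mB ->]] /=; rewrite -[X in measurable X]setTI.
    have mn : measurable_fun setT (fun s : S => map_mx Num.norm (bt s) 0 i).
      under eq_fun do rewrite mxE.
      exact: measurableT_comp (measurable_btil i).
    exact: (mn measurableT _ mB).
  - move=> C [mC ->] /=; rewrite -[X in measurable X]setTI.
    exact: (measurable_aux measurableT mC).
exact: (H _ (mrule o)).
Qed.

Lemma measurable_outb o : measurable_fun setT (fun s : S => out s == o).
Proof.
apply: (measurable_fun_bool true); rewrite setTI.
rewrite [X in measurable X](_ : _ = [set s : S | out s = o]); first exact: measurable_out.
by apply/seteqP; split => s /= /eqP.
Qed.

(** The absolute values make this an upper bound for the log density ratio of the flip whichever
    sign occurs, and make it invariant under all flips. *)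
Definition log_odds j (s : S) : R := 2 * `|beta 0 j| * `|bt s 0 j| / (sigma2 * Delta j j).
Definition strong j (s : S) : bool := - ln alpha / 2 < log_odds j s.
Definition strongs (s : S) : {ffun 'I_d -> bool} := [ffun j => strong j s].

Lemma measurable_log_odds j : measurable_fun setT (log_odds j).
Proof.
apply: measurable_funM => //; apply: measurable_funM => //.
exact: measurableT_comp (measurable_btil j).
Qed.

Lemma measurable_strong j : measurable_fun setT (strong j).
Proof. by apply: measurable_fun_ltr => //; exact: measurable_log_odds. Qed.

Lemma measurable_strongsb g : measurable_fun setT (fun s : S => strongs s == g).
Proof.
apply: (measurable_fun_bool true); rewrite setTI.
rewrite [X in measurable X](_ : _ =
    \bigcap_(j in [set: 'I_d]) (strong j @^-1` [set g j])).
  apply: fin_bigcap_measurable => // j _; rewrite -[X in measurable X]setTI.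
  by apply: measurable_strong.
apply/seteqP; split => s /=.
  by move=> /eqP <- j _ /=; rewrite ffunE.
by move=> H; apply/eqP/ffunP => j; rewrite ffunE; exact: H.
Qed.

Lemma phalfE (b : 'rV[R]_d) psi j :
  phalf b psi j = if psi j then 0 < b 0 j else b 0 j < 0.
Proof.
rewrite /phalf; case: ifP => _; first by rewrite sgr_cp0.
by rewrite sgr_cp0.
Qed.

Lemma measurable_phalf psi j : measurable_fun setT (fun s : S => phalf (bt s) psi j).
Proof.
under eq_fun do rewrite phalfE.
by case: (psi j); apply: measurable_fun_ltr => //; exact: measurable_btil.
Qed.

Lemma out_flip j s : out (gact (flp j) s) = out s.
Proof. by rewrite /out /= (xi_flip beta s0 Spd Dd DS AA BB) (norm_btil_flip beta s0 Spd Dd DS AA BB). Qed.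

Lemma log_odds_flip i j s : log_odds i (gact (flp j) s) = log_odds i s.
Proof.
rewrite /log_odds; congr (_ * _ / _).
have := congr1 (fun M : 'rV[R]_d => M 0 i) (norm_btil_flip beta s0 Spd Dd DS AA BB j s.1).
by rewrite !mxE.
Qed.

Lemma strongs_flip j s : strongs (gact (flp j) s) = strongs s.
Proof. by apply/ffunP => i; rewrite !ffunE /strong log_odds_flip. Qed.

(** Only an implication: on the mirror itself the sign is 0, and [phalf] fails both before and after
    the flip. *)
Lemma phalf_flip j (s : S) psi : phalf (bt (gact (flp j) s)) psi j -> ~~ phalf (bt s) psi j.
Proof.
rewrite !phalfE /= (btil_flip beta s0 Spd Dd DS AA BB) !mxE !eqxx mulr1.
by case: (psi j); rewrite -leNgt => ?; lra.
Qed.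

Lemma phalf_flip_neq i j (s : S) psi : i != j ->
  phalf (bt (gact (flp j) s)) psi i = phalf (bt s) psi i.
Proof.
move=> ij; rewrite !phalfE /= (btil_flip beta s0 Spd Dd DS AA BB) !mxE eqxx (negbTE ij).
by rewrite mulr0 subr0.
Qed.

Lemma unimodular_flip j : unimodular mu (flp j).
Proof. by have [i wi] := wrow_neq0 Spd DS AA BB j; apply: (unimodular_affine_refl mu_gauss _ wi). Qed.

Lemma dratio_flip_le j s : ~~ strong j s -> dratio (flp j) s.1 <= expR (- ln alpha / 2).
Proof.
rewrite -leNgt => h; rewrite (dratio_flip beta s0 Spd DS AA BB) ler_expR.
apply: le_trans h; rewrite /log_odds -mulNr ler_wpM2r//.
  by rewrite invr_ge0 mulr_ge0 ?ltW//; exact: (diag_gt0 Spd DS).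
by rewrite -!mulrA -normrM -mulrN ler_wpM2l// -normrN ler_norm.
Qed.

(** The conditional odds of p~_j = 1/2 are at most alpha^(-1/2), stated by testing against invariant
    weights [Phi] instead of conditioning. The flip carries the first event into the second, and its
    density ratio is bounded wherever [Phi] does not vanish. *)
Lemma flip_bound psi j (Phi : S -> R) :
  measurable_fun setT Phi -> (forall s, 0 <= Phi s) ->
  (forall s, Phi (gact (flp j) s) = Phi s) -> (forall s, strong j s -> Phi s = 0) ->
  (\int[mu]_s (Phi s * (phalf (bt s) psi j)%:R)%:E <=
   (expR (- ln alpha / 2))%:E * \int[mu]_s (Phi s * (~~ phalf (bt s) psi j)%:R)%:E)%E.
Proof.
move=> mP P0 Pf Pb.
have mh (g : bool -> R) : measurable_fun setT (fun s => Phi s * g (phalf (bt s) psi j)).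
  apply: measurable_funM => //; apply: measurable_fun_of_bool; exact: measurable_phalf.
have [mf /(_ (fun s => (Phi s * (phalf (bt s) psi j)%:R)%:E)) <-] := unimodular_flip j; last 2 first.
- by apply/measurable_EFinP; exact: (mh (fun b : bool => b%:R)).
- by move=> s; rewrite lee_fin mulr_ge0.
rewrite -ge0_integralZl//; last 2 first.
- by apply/measurable_EFinP; exact: (mh (fun b : bool => (~~ b)%:R)).
- by move=> s _; rewrite lee_fin mulr_ge0.
apply: ge0_le_integral => //.
- by move=> s _; rewrite mule_ge0// lee_fin ?mulr_ge0// expR_ge0.
- apply: emeasurable_funM; last by apply/measurable_EFinP; exact: measurable_dratio.
  have mg : measurable_fun setT (fun s => (Phi s * (phalf (bt s) psi j)%:R)%:E).
    by apply/measurable_EFinP; exact: (mh (fun b : bool => b%:R)).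
  exact: (measurableT_comp mg mf).
- apply: emeasurable_funM => //.
  by apply/measurable_EFinP; exact: (mh (fun b : bool => (~~ b)%:R)).
move=> s _; rewrite Pf -!EFinM lee_fin.
have [/Pb ->|nb] := boolP (strong j s); first by rewrite !mul0r mulr0.
have := dratio_flip_le nb; set D := dratio _ _; set th := expR _ => Dth.
have D0 : 0 <= D by exact: expR_ge0.
have [/phalf_flip ->|_] := boolP (phalf (bt (gact _ _)) _ _).
  by rewrite !mulr1 mulrC ler_wpM2r.
by rewrite mulr0 mul0r mulr_ge0 ?mulr_ge0// expR_ge0.
Qed.

Variables eta c rho : R.
Hypotheses (eta0 : 0 < eta) (c0 : 0 < c).
Hypothesis rhoE : rho * (expR (- ln alpha / 2) + 1)
  = expR eta * expR (- ln alpha / 2) + expR (- (eta * c)).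

Let r0 : 0 <= rho.
Proof.
have th0 : 0 < expR (- ln alpha / 2) + 1 by rewrite addr_gt0// expR_gt0.
by rewrite -(pmulr_lge0 _ th0) rhoE addr_ge0// ?mulr_ge0// expR_ge0.
Qed.

(** By [rhoE], [rho] is the mean step weight at odds exactly alpha^(-1/2), the worst case allowed by
    [flip_bound]. *)
Lemma flip_step psi j (Phi : S -> R) :
  measurable_fun setT Phi -> (forall s, 0 <= Phi s) ->
  (forall s, Phi (gact (flp j) s) = Phi s) -> (forall s, strong j s -> Phi s = 0) ->
  (\int[mu]_s (Phi s * walk_weight eta c (phalf (bt s) psi j))%:E <=
   rho%:E * \int[mu]_s (Phi s)%:E)%E.
Proof.
move=> mP P0 Pf Pb; have := flip_bound psi mP P0 Pf Pb.
have mh (g : bool -> R) : measurable_fun setT (fun s => (Phi s * g (phalf (bt s) psi j))%:E).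
  apply/measurable_EFinP; apply: measurable_funM => //.
  by apply: measurable_fun_of_bool; exact: measurable_phalf.
have mp := mh (fun b : bool => b%:R); have mq := mh (fun b : bool => (~~ b)%:R).
set p := (\int[mu]_s _)%E; set q := (\int[mu]_s _)%E; set th := expR _ => pq.
have th0 : 0 < th by exact: expR_gt0.
pose E := expR eta; pose w := expR (- (eta * c)).
have E0 : 0 < E by exact: expR_gt0.
have w0 : 0 < w by exact: expR_gt0.
have w1 : w <= 1 by rewrite -expR0 ler_expR oppr_le0 mulr_ge0 ?ltW.
have E1 : 1 <= E by rewrite -expR0 ler_expR ltW.
have Er : (E - rho) * th = rho - w.
  by move: rhoE; rewrite -/th -/E -/w => H; lra.
have rE : rho <= E by move: rhoE; rewrite -/th -/E -/w => H; nra.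
have wr : w <= rho by move: rhoE; rewrite -/th -/E -/w => H; nra.
have p0 : (0 <= p)%E by apply: integral_ge0 => s _; rewrite lee_fin mulr_ge0.
have q0 : (0 <= q)%E by apply: integral_ge0 => s _; rewrite lee_fin mulr_ge0.
have -> : (\int[mu]_s (Phi s)%:E = p + q)%E.
  rewrite -ge0_integralD//; [|by move=> s _; rewrite lee_fin mulr_ge0..].
  apply: eq_integral => s _; rewrite -EFinD -mulrDr.
  by case: (phalf _ _ _); rewrite /= ?addr0 ?add0r mulr1.
have -> : (\int[mu]_s (Phi s * walk_weight eta c (phalf (bt s) psi j))%:E = E%:E * p + w%:E * q)%E.
  rewrite -!ge0_integralZl ?lee_fin ?ltW//; [|by move=> s _; rewrite lee_fin mulr_ge0..].
  rewrite -ge0_integralD//.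
  - apply: eq_integral => s _; rewrite -!EFinM -EFinD /walk_weight; congr EFin.
    by case: (phalf _ _ _); rewrite /= ?mulr0 ?mulr1 ?addr0 ?add0r mulrC.
  - by move=> s _; rewrite mule_ge0// lee_fin ?mulr_ge0// ltW.
  - exact: emeasurable_funM.
  - by move=> s _; rewrite mule_ge0// lee_fin ?mulr_ge0// ltW.
  - exact: emeasurable_funM.
exact: (odds_step p0 q0 pq Er rE (ltW w0) wr).
Qed.

(* The ordering, the signs and the strong indices are constant on a cell, and
   cells are invariant under all the flips. *)
Definition cell o g (s : S) : bool := (out s == o) && (strongs s == g).

Lemma measurable_cell o g : measurable_fun setT (cell o g).
Proof. by apply: measurable_and; [exact: measurable_outb|exact: measurable_strongsb]. Qed.

(** This plays the part of conditional independence: the cell and the factors of the other indices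
    are unchanged by flip [j], so together they can serve as the weight [Phi] when factor [j] is
    removed. *)
Lemma flip_prod o (g : {ffun 'I_d -> bool}) (J : seq 'I_d) : uniq J -> all (fun j => ~~ g j) J ->
  (\int[mu]_s ((cell o g s)%:R * \prod_(j <- J) walk_weight eta c (phalf (bt s) o.2 j))%:E <=
   (rho ^+ size J)%:E * \int[mu]_s ((cell o g s)%:R)%:E)%E.
Proof.
elim: J => [|j J IH] /=.
  by move=> _ _; rewrite expr0 mul1e; under eq_integral do rewrite big_nil mulr1.
move=> /andP[jJ uJ] /andP[gj aJ].
under eq_integral do rewrite big_cons mulrCA mulrC.
apply: (le_trans (flip_step _ _ _ _ _)).
- apply: measurable_funM.
    exact: (measurable_fun_of_bool (fun b : bool => b%:R) (measurable_cell o g)).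
  apply: (@measurable_prod _ _ _ _ _ _ (fun i (s : S) => walk_weight eta c (phalf (bt s) o.2 i))) => i _.
  exact: (measurable_fun_of_bool (walk_weight eta c) (measurable_phalf _ _)).
- by move=> s; rewrite mulr_ge0// prodr_ge0// => i _; exact: expR_ge0.
- move=> s; rewrite /cell out_flip strongs_flip; congr (_%:R * _).
  apply: eq_big_seq => i iJ.
  by rewrite phalf_flip_neq//; apply: contraNneq jJ => <-.
- move=> s bj; rewrite /cell; have -> : (strongs s == g) = false.
    by apply/negbTE; apply: contraNneq gj => <-; rewrite ffunE.
  by rewrite andbF mul0r.
rewrite exprS EFinM -muleA; apply: lee_wpmul2l; first by rewrite lee_fin.
exact: IH.
Qed.

Hypothesis rho1 : rho < 1.

Lemma measurable_cellR o g : measurable_fun setT (fun s => (cell o g s)%:R : R).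
Proof. exact: (measurable_fun_of_bool (fun b : bool => b%:R) (measurable_cell o g)). Qed.

(** On a cell the order and the signs are fixed, so the term at time [t] is a product over the fixed
    list [J t]. [flip_prod] turns it into a power of [rho], and [sum_geom_count] sums these
    powers. *)
Lemma integral_cell_walk_sum o (g : {ffun 'I_d -> bool}) :
  (\int[mu]_s ((cell o g s)%:R * walk_sum eta c o.1 (phalf (bt s) o.2) g)%:E <=
   ((1 - rho)^-1)%:E * \int[mu]_s ((cell o g s)%:R)%:E)%E.
Proof.
pose J (t : 'I_d) := [seq o.1 j | j <- [seq j : 'I_d <- enum 'I_d | (j <= t)%N && ~~ g (o.1 j)]].
pose H t (s : S) : R := (cell o g s)%:R * \prod_(j <- J t) walk_weight eta c (phalf (bt s) o.2 j).
have -> : (\int[mu]_s ((cell o g s)%:R * walk_sum eta c o.1 (phalf (bt s) o.2) g)%:E =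
    \int[mu]_s \sum_(t <- [seq t <- index_enum 'I_d | ~~ g (o.1 t)]) (H t s)%:E)%E.
  apply: eq_integral => s _; rewrite big_filter /walk_sum mulr_sumr sumEFin; congr EFin.
  apply: eq_bigr => t _; rewrite /H; congr (_ * _).
  by rewrite big_map big_filter big_enum_cond.
rewrite ge0_integral_sum//; last 2 first.
- move=> t; apply/measurable_EFinP; apply: measurable_funM; first exact: measurable_cellR.
  apply: (@measurable_prod _ _ _ _ _ _ (fun i (s : S) => walk_weight eta c (phalf (bt s) o.2 i))) => i _.
  exact: (measurable_fun_of_bool (walk_weight eta c) (measurable_phalf _ _)).
- move=> t s _; rewrite lee_fin mulr_ge0// prodr_ge0// => i _; exact: expR_ge0.
rewrite big_filter; set I := (\int[mu]_s ((cell o g s)%:R)%:E)%E.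
have I0 : (0 <= I)%E by apply: integral_ge0 => s _; rewrite lee_fin.
apply: (@le_trans _ _ (\sum_(t < d | ~~ g (o.1 t))
    (rho ^+ #|[pred j : 'I_d | (j <= t)%N && ~~ g (o.1 j)]|)%:E * I)%E).
  apply: lee_sum => t gt.
  have -> : #|[pred j : 'I_d | (j <= t)%N && ~~ g (o.1 j)]| = size (J t).
    by rewrite size_map size_filter enumT cardE /enum_mem size_filter; apply: eq_count.
  apply: flip_prod.
    rewrite map_inj_uniq; last exact: perm_inj.
    by apply: filter_uniq; exact: enum_uniq.
  by apply/allP => _ /mapP[j + ->]; rewrite mem_filter => /andP[/andP[]].
rewrite -ge0_sume_distrl; last by move=> t _; rewrite lee_fin exprn_ge0.
apply: lee_wpmul2r => //; rewrite sumEFin lee_fin.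
by apply: (@sum_geom_count R rho d (fun t => ~~ g (o.1 t))); rewrite r0.
Qed.

(** The cells form a finite partition, which replaces the random order, signs and strong set by
    fixed ones. *)
Lemma sum_cell (s : S) (F : ({perm 'I_d} * {ffun 'I_d -> bool}) * {ffun 'I_d -> bool} -> R) :
  F (out s, strongs s) = \sum_og (cell og.1 og.2 s)%:R * F og.
Proof.
rewrite (bigD1 (out s, strongs s))//= /cell !eqxx mul1r big1 ?addr0// => -[p g] /= neq.
case: eqP => //= [e1|]; last by rewrite mul0r.
by case: eqP => //= [e2|]; [rewrite e1 e2 eqxx in neq|rewrite mul0r].
Qed.

Lemma measurable_cell_walk_sum (og : ({perm 'I_d} * {ffun 'I_d -> bool}) * {ffun 'I_d -> bool}) :
  measurable_fun setT (fun s =>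
    (cell og.1 og.2 s)%:R * walk_sum eta c og.1.1 (phalf (bt s) og.1.2) og.2 : R).
Proof.
apply: measurable_funM; first exact: measurable_cellR.
under eq_fun do rewrite /walk_sum big_mkcond /=.
apply: (@measurable_sum _ _ _ _ _ _ (fun t (s : S) => if ~~ og.2 (og.1.1 t) then
  \prod_(j < d | (j <= t)%N && ~~ og.2 (og.1.1 j)) walk_weight eta c (phalf (bt s) og.1.2 (og.1.1 j)) else 0)) => t.
case: (~~ og.2 (og.1.1 t)) => //; under eq_fun do rewrite -big_filter.
apply: (@measurable_prod _ _ R setT 'I_d _
  (fun (j : 'I_d) (s : S) => walk_weight eta c (phalf (bt s) og.1.2 (og.1.1 j)))) => j _.
exact: (measurable_fun_of_bool (walk_weight eta c) (measurable_phalf _ _)).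
Qed.

Lemma measurable_walk_sum : measurable_fun setT (fun s =>
  walk_sum eta c (out s).1 (phalf (bt s) (out s).2) (strongs s)).
Proof.
under eq_fun => s do
  rewrite (sum_cell s (fun og => walk_sum eta c og.1.1 (phalf (bt s) og.1.2) og.2)).
apply: measurable_sum => og; exact: measurable_cell_walk_sum.
Qed.

Lemma integral_walk_sum :
  (\int[mu]_s (walk_sum eta c (out s).1 (phalf (bt s) (out s).2) (strongs s))%:E <=
   ((1 - rho)^-1)%:E)%E.
Proof.
pose H og (s : S) : R := (cell og.1 og.2 s)%:R * walk_sum eta c og.1.1 (phalf (bt s) og.1.2) og.2.
have -> : (\int[mu]_s (walk_sum eta c (out s).1 (phalf (bt s) (out s).2) (strongs s))%:E =
    \int[mu]_s \sum_og (H og s)%:E)%E.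
  apply: eq_integral => s _; rewrite sumEFin; congr EFin.
  exact: (sum_cell s (fun og => walk_sum eta c og.1.1 (phalf (bt s) og.1.2) og.2)).
rewrite ge0_integral_sum//; last 2 first.
- by move=> og; apply/measurable_EFinP; exact: measurable_cell_walk_sum.
- by move=> og s _; rewrite lee_fin mulr_ge0// walk_sum_ge0.
apply: (@le_trans _ _ (\sum_og ((1 - rho)^-1)%:E * \int[mu]_s ((cell og.1 og.2 s)%:R)%:E)%E).
  by apply: lee_sum => og _; exact: integral_cell_walk_sum.
rewrite -ge0_sume_distrr; last by move=> og _; apply: integral_ge0 => s _; rewrite lee_fin.
rewrite -ge0_integral_sum//; last by move=> og; apply/measurable_EFinP; exact: measurable_cellR.
have -> : (\int[mu]_s \sum_og ((cell og.1 og.2 s)%:R)%:E = \int[mu]_s (cst 1 s))%E.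
  apply: eq_integral => s _; rewrite sumEFin; congr EFin.
  apply: etrans (esym (sum_cell s (fun=> 1))).
  by apply: eq_bigr => og _; rewrite mulr1.
rewrite integral_cst// mul1e.
by rewrite [X in (_ * X)%E](_ : _ = 1%E) ?mule1//; exact: probability_setT.
Qed.

(** * Expected number of strong indices *)

Lemma mgf_btil j (a : R) :
  (\int[mu]_s (expR (a * bt s 0 j))%:E =
    (expR (a * beta 0 j + a ^+ 2 * (sigma2 * Delta j j) / 2))%:E)%E.
Proof.
pose w := (a * Num.sqrt sigma2) *: wrow A B j.
have wE : nsq w = a ^+ 2 * (sigma2 * Delta j j).
  rewrite -(nsq_wrow AA BB) /nsq !mulr_sumr; apply: eq_bigr => i _.
  by rewrite mxE exprMn exprMn sqr_sqrtr ?ltW// -!mulrA.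
rewrite expRD EFinM -wE -(gauss_mgf mu_gauss w).
rewrite -ge0_integralZl//.
- apply: eq_integral => s _; rewrite -EFinM -expRD; congr (expR _)%:E.
  rewrite btil_dotr mulrDr; congr (_ + _); rewrite mulrA /dotr !mulr_sumr.
  by apply: eq_bigr => i _; rewrite [w 0 i]mxE; ring.
- apply/measurable_EFinP; apply: measurableT_comp => //.
  have := @measurable_affine_form R (d + d) _ Aux (fun l => w 0 l) xpredT 0.
  by congr measurable_fun; apply/funext => s; rewrite addr0; apply: eq_bigr => i _; rewrite mulrC.
Qed.

Hypothesis alpha01 : 0 < alpha < 1.

(** The value 1 covers the case v >= 1 of [integral_strong], where a probability is at most 1 <= v;
    the other value comes from the Markov bound for v < 1. *)
Definition strong_const : R := Num.max 1 (64 * expR (3 / 2) / ln alpha ^+ 2).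

(** This lets the Markov bound for the square of [bt] use the exponential moments of [mgf_btil]. *)
Lemma sqr_le_cosh (x : R) : x ^+ 2 <= 4 * (expR x + expR (- x)).
Proof.
have H (y : R) : 0 <= y -> y ^+ 2 <= 4 * expR y.
  move=> y0; have := expR_ge1Dxn 1 y0; rewrite (_ : 2`!%N = 2%N)//.
  by have := sqr_ge0 y; lra.
have p1 := expR_gt0 x; have p2 := expR_gt0 (- x).
have [x0|x0] := leP 0 x; first by have := H x x0; lra.
have : 0 <= - x by rewrite oppr_ge0 ltW.
by move=> /H; rewrite sqrrN; lra.
Qed.

Lemma integral_strong j : (\int[mu]_s ((strong j s)%:R)%:E <=
  (strong_const * (2 * beta 0 j ^+ 2 / (sigma2 * Delta j j)))%:E)%E.
Proof.
have Dj := diag_gt0 Spd DS j.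
set v := 2 * _ / _.
have v0 : 0 <= v by apply: divr_ge0; [rewrite mulr_ge0 ?sqr_ge0|rewrite ltW// mulr_gt0].
have mb : measurable_fun setT (fun s : S => ((strong j s)%:R : R)%:E).
  apply/measurable_EFinP.
  exact: (measurable_fun_of_bool (fun b : bool => b%:R) (measurable_strong j)).
have K1 : 1 <= strong_const by rewrite le_max lexx.
have [v1|v1] := leP 1 v.
  apply: (@le_trans _ _ (\int[mu]_s (cst 1 s))%E).
    by apply: ge0_le_integral => // s _; rewrite lee_fin //=; case: (strong j s).
  rewrite integral_cst// mul1e [X in (X <= _)%E](_ : _ = 1%E); last exact: probability_setT.
  by rewrite lee_fin; nra.
pose tau := Num.sqrt (sigma2 * Delta j j).
have sD0 : 0 < sigma2 * Delta j j by rewrite mulr_gt0.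
have tau0 : 0 < tau by rewrite sqrtr_gt0.
have tau2 : tau ^+ 2 = sigma2 * Delta j j by rewrite sqr_sqrtr// ltW.
pose L := ln alpha.
have L0 : L < 0 by rewrite ln_lt0.
(* With x = [bt] / tau, the squared log odds equal 2 v x^2, so a strong index has 1 <= 8 v x^2 /
   L^2; [sqr_le_cosh] contributes the remaining factor 4. *)
pose k0 := 32 * v / L ^+ 2.
have L2 : 0 < L ^+ 2 by rewrite exprn_even_gt0//= lt_eqF.
have k00 : 0 <= k0 by apply: divr_ge0; [exact: mulr_ge0|exact: ltW].
have mE (a : R) : measurable_fun setT (fun s : S => (expR (a * bt s 0 j))%:E).
  apply/measurable_EFinP; apply: measurableT_comp => //; apply: measurable_funM => //.
  exact: measurable_btil.
have pE (a : R) (s : S) : setT s -> (0 <= (expR (a * bt s 0 j))%:E)%E.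
  by rewrite lee_fin expR_ge0.
apply: (@le_trans _ _ (\int[mu]_s (k0%:E * ((expR (tau^-1 * bt s 0 j))%:E
    + (expR (- tau^-1 * bt s 0 j))%:E)))%E).
  apply: ge0_le_integral => //.
  - by apply: emeasurable_funM => //; apply: emeasurable_funD; exact: mE.
  move=> s _; rewrite -EFinD -EFinM lee_fin.
  have [b|_] := boolP (strong j s); last by rewrite mulr_ge0// addr_ge0// expR_ge0.
  set x := tau^-1 * bt s 0 j; rewrite mulNr -/x.
  have hx := sqr_le_cosh x.
  have xE : x ^+ 2 * tau ^+ 2 = bt s 0 j ^+ 2.
    by rewrite /x exprMn exprVn mulrAC mulVf ?mul1r// expf_neq0// gt_eqF.
  have : (- L / 2) ^+ 2 <= log_odds j s ^+ 2.
    rewrite ler_pXn2r// ?nnegrE; [exact: ltW|by rewrite divr_ge0// oppr_ge0 ltW|].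
    by apply: le_trans (ltW b); rewrite divr_ge0// oppr_ge0 ltW.
  have -> : log_odds j s ^+ 2 = 2 * v * x ^+ 2.
    rewrite /log_odds /v -tau2 exprMn exprMn exprMn !real_normK ?num_real// -xE.
    by field; rewrite gt_eqF.
  rewrite /k0 => h; have : L ^+ 2 <= 32 * v * (expR x + expR (- x)) by nra.
  by move=> h2; rewrite [leRHS]mulrAC ler_pdivlMr// mul1r.
rewrite ge0_integralZl//; last 2 first.
- by apply: emeasurable_funD; exact: mE.
- by move=> s _; rewrite adde_ge0// lee_fin expR_ge0.
rewrite (ge0_integralD mu measurableT (pE _) (mE _) (pE _) (mE _)).
rewrite !mgf_btil -EFinD -EFinM lee_fin.
(* Since v < 1, the mean of x is at most 1 in absolute value and its variance is 1. Both exponential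
   moments are thus at most exp(1 + 1/2). *)
have e1 : `|tau^-1 * beta 0 j| <= 1.
  rewrite -(@ler_pXn2r _ 2)// ?nnegrE// real_normK ?num_real// expr1n exprMn exprVn tau2.
  by rewrite mulrC; move: v1; rewrite /v -mulrA; nra.
have t1 : tau^-1 ^+ 2 * (sigma2 * Delta j j) / 2 = 1 / 2.
  by rewrite -tau2; field; rewrite gt_eqF.
have B1 : expR (tau^-1 * beta 0 j + tau^-1 ^+ 2 * (sigma2 * Delta j j) / 2) <= expR (3 / 2).
  by rewrite ler_expR t1; move: (ler_norm (tau^-1 * beta 0 j)) => ?; lra.
have B2 : expR (- tau^-1 * beta 0 j + (- tau^-1) ^+ 2 * (sigma2 * Delta j j) / 2) <= expR (3 / 2).
  rewrite ler_expR sqrrN t1 mulNr; move: (ler_norm (- (tau^-1 * beta 0 j))).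
  by rewrite normrN => ?; lra.
apply: (@le_trans _ _ (k0 * (2 * expR (3 / 2)))).
  by apply: ler_wpM2l => //; lra.
have -> : k0 * (2 * expR (3 / 2)) = (64 * expR (3 / 2) / ln alpha ^+ 2) * v.
  by rewrite /k0 -/L; field; rewrite lt_eqF.
by apply: ler_wpM2r => //; rewrite le_max lexx orbT.
Qed.

Lemma card_strongs s : #|[pred j | strongs s j]|%:R = \sum_(j < d) (strong j s)%:R :> R.
Proof.
rewrite -sum1_card natr_sum big_mkcond; apply: eq_bigr => j _.
by rewrite inE ffunE; case: (strong j s).
Qed.

Lemma integral_card_strongs (G : pred 'I_d) k :
  (#|[predC G]| <= 2 * k)%N ->
  \sum_(j | G j) (2 * beta 0 j ^+ 2 / (sigma2 * Delta j j)) <= - ln alpha / 2 * k%:R ->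
  (\int[mu]_s (#|[pred j | strongs s j]|%:R)%:E <= ((2 + strong_const * (- ln alpha / 2)) * k%:R)%:E)%E.
Proof.
move=> cG sG.
have mb j : measurable_fun setT (fun s : S => ((strong j s)%:R : R)%:E).
  apply/measurable_EFinP.
  exact: (measurable_fun_of_bool (fun b : bool => b%:R) (measurable_strong j)).
have -> : (\int[mu]_s (#|[pred j | strongs s j]|%:R)%:E = \int[mu]_s \sum_(j < d) ((strong j s)%:R)%:E)%E.
  by apply: eq_integral => s _; rewrite card_strongs sumEFin.
rewrite ge0_integral_sum//.
(* Indices outside [G] are counted with the trivial probability bound 1, those in [G] with
   [integral_strong]. *)
rewrite (bigID G)/= mulrDl [X in (_ <= X%:E)%E]addrC EFinD; apply: leeD; last first.
  apply: (@le_trans _ _ (\sum_(j | ~~ G j) 1)%E).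
    apply: lee_sum => j _; apply: (@le_trans _ _ (\int[mu]_s (cst 1 s))%E).
      by apply: ge0_le_integral => // s _; rewrite lee_fin //=; case: (strong j s).
    rewrite integral_cst// mul1e [X in (X <= _)%E](_ : _ = 1%E)//; exact: probability_setT.
  rewrite sumEFin lee_fin -(natrM _ 2 k).
  have -> : \sum_(j | ~~ G j) 1 = #|[predC G]|%:R :> R.
    by rewrite -sum1_card natr_sum; apply: eq_bigl => j; rewrite inE.
  by rewrite ler_nat.
apply: (@le_trans _ _ (\sum_(j | G j) (strong_const * (2 * beta 0 j ^+ 2 / (sigma2 * Delta j j)))%:E)%E).
  by apply: lee_sum => j _; exact: integral_strong.
rewrite sumEFin lee_fin -mulr_sumr -mulrA ler_wpM2l//.
by apply: le_trans (ler01) _; rewrite le_max lexx.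
Qed.

Lemma integral_bound (a K : R) : 0 < a < 1 ->
  (\int[mu]_s (#|[pred j | strongs s j]|%:R)%:E <= K%:E)%E ->
  (\int[mu]_s ((1 + (1 - a)^-1) * #|[pred j | strongs s j]|%:R
     + walk_sum eta c (out s).1 (phalf (bt s) (out s).2) (strongs s) / eta / (1 - a))%:E
   <= ((1 + (1 - a)^-1) * K + (1 - rho)^-1 / eta / (1 - a))%:E)%E.
Proof.
move=> /andP[a0 a1] bK.
have a1' : 0 < 1 - a by rewrite subr_gt0.
have D0 : 0 <= 1 + (1 - a)^-1 by rewrite addr_ge0// invr_ge0 ltW.
have e0 : 0 <= eta^-1 / (1 - a) by apply: divr_ge0; rewrite ?invr_ge0; exact: ltW.
have mc : measurable_fun setT (fun s : S => (#|[pred j | strongs s j]|%:R : R)%:E).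
  apply/measurable_EFinP; under eq_fun do rewrite card_strongs.
  apply: measurable_sum => j.
  exact: (measurable_fun_of_bool (fun b : bool => b%:R) (measurable_strong j)).
have mF : measurable_fun setT (fun s =>
    (walk_sum eta c (out s).1 (phalf (bt s) (out s).2) (strongs s))%:E).
  by apply/measurable_EFinP; exact: measurable_walk_sum.
have -> : (\int[mu]_s ((1 + (1 - a)^-1) * #|[pred j | strongs s j]|%:R
     + walk_sum eta c (out s).1 (phalf (bt s) (out s).2) (strongs s) / eta / (1 - a))%:E =
   \int[mu]_s ((1 + (1 - a)^-1)%:E * (#|[pred j | strongs s j]|%:R)%:E + (eta^-1 / (1 - a))%:E *
     (walk_sum eta c (out s).1 (phalf (bt s) (out s).2) (strongs s))%:E))%E.
  by apply: eq_integral => s _; rewrite -!EFinM -EFinD; congr EFin; congr (_ + _); ring.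
rewrite ge0_integralD//; first last.
- exact: emeasurable_funM.
- by move=> s _; rewrite mule_ge0// lee_fin walk_sum_ge0.
- exact: emeasurable_funM.
- by move=> s _; rewrite mule_ge0// lee_fin.
rewrite !ge0_integralZl//; last by move=> s _; rewrite lee_fin walk_sum_ge0.
rewrite [leRHS]EFinD; apply: leeD; first by rewrite [leRHS]EFinM; apply: lee_wpmul2l.
rewrite (_ : (1 - rho)^-1 / eta / (1 - a) = (eta^-1 / (1 - a)) * (1 - rho)^-1); last by ring.
by rewrite [leRHS]EFinM; apply: lee_wpmul2l => //; exact: integral_walk_sum.
Qed.

End core.

(* Unlike in [ge0_le_integral], the functions need not be measurable. *)
Lemma le_ge0_integral {d : measure_display} {T : measurableType d} {R : realType}
    (mu : {measure set T -> \bar R}) (f g : T -> \bar R) :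
  (forall x, 0 <= f x)%E -> (forall x, f x <= g x)%E ->
  (\int[mu]_x f x <= \int[mu]_x g x)%E.
Proof.
move=> f0 fg; have g0 x : (0 <= g x)%E by exact: le_trans (f0 x) (fg x).
rewrite !ge0_integralTE//; apply: ereal_sup_le => _ [h hf <-].
by exists h => // x; exact: le_trans (hf x) (fg x).
Qed.

(** * Choice of the constants and transfer to the law of the Gaussian and auxiliary variables *)

Theorem theorem2 (R : realType) (alpha : R) :
  0 < alpha < 1 ->
  exists C1 C2 : R,
  forall (d : nat) (Sigma : 'M[R]_d) (beta : 'rV[R]_d) (sigma2 : R)
         (Q : 'M[R]_d) (lam : 'I_d -> R) (k : nat),
    pd_mx Sigma -> 0 < sigma2 ->
    Q^T *m Q = 1%:M ->
    (forall l : 'I_d, Sigma *m col l Q = lam l *: col l Q) ->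
    (1 <= k <= d)%N ->
    k_cond alpha sigma2 beta Q lam k ->
    (forall j : nat, (1 <= j < k)%N -> ~ k_cond alpha sigma2 beta Q lam j) ->
  forall (Delta A B : 'M[R]_d),
    is_diag_mx Delta -> psd_mx (Delta - Sigma) ->
    A *m A^T = Sigma -> B *m B^T = Delta - Sigma ->
  forall (dT : measure_display) (T : measurableType dT) (P : probability T R)
         (dA : measure_display) (Aux : measurableType dA)
         (Z : T -> 'rV[R]_(d + d)) (U : T -> Aux)
         (rule : 'rV[R]_d -> 'rV[R]_d -> Aux -> {perm 'I_d} * {ffun 'I_d -> bool}),
    std_gauss_indep P Z U ->
    rule_measurable rule ->
    (\int[P]_t ((knockoff_R alpha sigma2 beta Sigma Delta A B rule (Z t) (U t))%:R)%:E
       <= (C1 * k%:R + C2)%:E)%E.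
Proof.
move=> alpha01; have /andP[al0 al1] := alpha01.
have L0 : ln alpha < 0 by rewrite ln_lt0.
(* [th] is alpha^(-1/2) and [c] is alpha^(-3/4). The exponent 3/4 lies strictly between 1/2, for the
   negative drift th < c, and 1, for a = c * alpha = alpha^(1/4) < 1. *)
pose th := expR (- ln alpha / 2); pose c := expR (- (3 / 4) * ln alpha).
pose a := expR (ln alpha / 4).
have th0 : 0 < th by exact: expR_gt0.
have c0 : 0 < c by exact: expR_gt0.
have thc : 0 < th < c by rewrite th0 ltr_expR; lra.
have [eta eta0 heta] := exists_eta thc.
have a01 : 0 < a < 1 by rewrite expR_gt0 -[ltRHS]expR0 ltr_expR; lra.
have ca : c * alpha = a.
  by rewrite -[in LHS](lnK al0) -expRD; congr expR; lra.
have th1 : 0 < th + 1 by rewrite addr_gt0.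
pose rho := (expR eta * th + expR (- (eta * c))) / (th + 1).
have rhoE : rho * (th + 1) = expR eta * th + expR (- (eta * c)).
  by rewrite divfK// gt_eqF.
have rho1 : rho < 1 by rewrite ltr_pdivrMr// mul1r.
exists ((1 + (1 - a)^-1) * (2 + strong_const alpha * (- ln alpha / 2))),
  ((1 - rho)^-1 / eta / (1 - a)).
move=> d Sigma beta sigma2 Q lam k Spd s0 Qo eigQ kd kc _ Delta A B Dd DS AA BB.
move=> dT T P dA Aux Z U rule [mZ [mU indep]] mrule.
have [G [cG sG]] := good_coordinates alpha01 s0 Spd Qo eigQ Dd DS kd kc.
pose S := gspace R (d + d) Aux.
pose ZU (t : T) : S := (Z t, U t).
have mZU : measurable_fun setT ZU by exact: measurable_gspace.
pose X : {mfun T >-> S} := mfun_Sub (mem_set mZU).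
pose mu : probability S R := distribution P X.
have mu_rect Bs C : mu (rect Bs C) =
    P (U @^-1` C `&` \bigcap_(i in [set: 'I_(d + d)]) ((fun t => Z t 0 i) @^-1` Bs i)).
  congr (P _); apply/seteqP; split => t /= [cU cB]; split => // i.
    by move=> _; exact: cB.
  exact: cB.
have mu_gauss (Bs : 'I_(d + d) -> set R) (C : set Aux) :
    (forall i, measurable (Bs i)) -> measurable C ->
    mu (rect Bs C) =
    (mu (rect (fun=> setT) C) * \prod_(i < d + d) normal_prob 0 1 (Bs i))%E.
  move=> mB mC; rewrite mu_rect indep//; congr (_ * _)%E.
  rewrite mu_rect; congr (P _); apply/seteqP; split => t /=; last by case.
  by move=> Ct; split.
pose bound (s : S) : R := (1 + (1 - a)^-1) * #|[pred j | strongs alpha sigma2 beta Delta A B s j]|%:R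
     + walk_sum eta c (out sigma2 beta Sigma Delta A B rule s).1
        (phalf (btil sigma2 beta A B s.1) (out sigma2 beta Sigma Delta A B rule s).2)
        (strongs alpha sigma2 beta Delta A B s) / eta / (1 - a).
have mbound : measurable_fun setT (fun s => (bound s)%:E).
  apply/measurable_EFinP; apply: measurable_funD; apply: measurable_funM => //.
    under eq_fun do rewrite card_strongs.
    apply: measurable_sum => j.
    exact: (measurable_fun_of_bool (fun b : bool => b%:R) (measurable_strong _ _ _ _ _ _ _)).
  by apply: measurable_funM => //; exact: (measurable_walk_sum _ _ _ _ _ _ _ mrule).
have bound0 s : 0 <= bound s.
  have a1 : 0 <= 1 - a by rewrite subr_ge0 ltW//; case/andP: a01.
  apply: addr_ge0; first by rewrite mulr_ge0// addr_ge0// invr_ge0.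
  by rewrite !mulr_ge0 ?walk_sum_ge0// invr_ge0// ltW.
apply: (@le_trans _ _ (\int[P]_t (bound (ZU t))%:E)%E).
  apply: le_ge0_integral => t; first by rewrite lee_fin.
  rewrite lee_fin.
  (* The pointwise bound is used with the random set of strong indices as [G]; [knockoff_R] unfolds
     to [n_rej] at [out]. *)
  exact: (n_rej_le _ _ _ _ eta0 a01 c0 ca).
have -> : (\int[P]_t (bound (ZU t))%:E = \int[mu]_s (bound s)%:E)%E.
  apply: esym; apply: (etrans (@ge0_integral_pushforward _ _ T S R X mZU P setT
    (fun s => (bound s)%:E) measurableT mbound _)) => // s _;
  by rewrite lee_fin.
have bK := integral_card_strongs s0 Spd DS AA BB mu_gauss alpha01 cG sG.
rewrite -(mulrA (1 + (1 - a)^-1)).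
exact: (integral_bound s0 Spd Dd DS AA BB mrule mu_gauss eta0 c0 rhoE rho1 a01 bK).
Qed.
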